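(* Let $k\ge 2$ be a fixed integer and let $f\in\mathcal{A}_0$. Then for every $\varepsilon>0$, $$\sum_{\substack{n_1,\ldots,n_k\in\mathbb{N}\\ n_1^2+\cdots+n_k^2\le x}}f([n_1,\ldots,n_k])=\frac{V_kE_{f,k}}{2^k}\,x^{k/2}+O\left(x^{k/2-1/4+\varepsilon}\right),$$ where $$E_{f,k}=\prod_p\left(1-\frac1p\right)^k\sum_{\nu_1,\ldots,\nu_k=0}^{\infty}\frac{f(p^{\max(\nu_1,\ldots,\nu_k)})}{p^{\nu_1+\cdots+\nu_k}}.$$
   Context: $\mathbb{N}=\{1,2,\ldots\}$, $[n_1,\ldots,n_k]$ is the least common multiple, and $\prod_p$ runs over all primes. $V_k=\pi^{k/2}/\Gamma(k/2+1)$ is the volume of the $k$-dimensional unit ball. $\mathcal{A}_0$ is the class of multiplicative functions $f:\mathbb{N}\to\mathbb{C}$ for which there exist real constants $C_1,C_2$ such that $|f(p)-1|\le C_1\,p^{-1/2}$ for every prime $p$ and $|f(p^{\nu})|\le C_2$ for every prime power $p^{\nu}$ with $\nu\ge 2$. The $O$-estimate is as $x\to\infty$, with implied constant depending only on $f$, $k$ and $\varepsilon$. *)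

(* Defs.v *)
From HB Require Import structures.
From mathcomp Require Import all_boot all_order all_algebra.
From mathcomp Require Import all_classical all_reals all_analysis.
From mathcomp.analysis.showcase Require summability.
From mathcomp Require Import complex.

Set Implicit Arguments.
Unset Strict Implicit.
Unset Printing Implicit Defensive.

Import Order.TTheory GRing.Theory Num.Theory.
Import numFieldNormedType.Exports.

Local Open Scope classical_set_scope.
Local Open Scope complex_scope.
Local Open Scope ring_scope.

(* The topology of R[i] given by the modulus.  The modulus of z : R[i] is the
   real element `|z| of R[i], and z <= w in R[i] means that w - z is a
   nonnegative real, so a bound by r : R is written `|z| <= r%:C. *)
#[warnings="-redundant-canonical-projection"]
HB.instance Definition _ (R : realType) :=
  NormedModule.copy R[i] ((R[i] : numFieldType)^o).

(* Functions on {1, 2, ...} are represented by functions on nat; the value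
   at 0 is irrelevant. *)
Definition multiplicative_fun (R : realType) (f : nat -> R[i]) : Prop :=
  f 1%N = 1 /\
  forall m n : nat, (0 < m)%N -> (0 < n)%N -> coprime m n ->
    f (m * n)%N = f m * f n.

Definition class_A0 (R : realType) (f : nat -> R[i]) : Prop :=
  multiplicative_fun f /\
  exists C1 C2 : R,
    (forall p : nat, prime p ->
       `|f p - 1| <= (C1 * p%:R `^ (- 2^-1))%:C) /\
    (forall p nu : nat, prime p -> (2 <= nu)%N -> `|f (p ^ nu)%N| <= C2%:C).

Definition Gamma (R : realType) (s : R) : R :=
  \int[lebesgue_measure]_(t in `]0, +oo[) (t `^ (s - 1) * expR (- t)).

Definition ball_volume (R : realType) (k : nat) : R :=
  pi `^ (k%:R / 2) / Gamma (k%:R / 2 + 1).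

Definition positive_tuples_in_ball (R : realType) (k : nat) (x : R) :
    set {ffun 'I_k -> nat} :=
  [set n | (forall i, (0 < n i)%N) /\ \sum_i (n i)%:R ^+ 2 <= x].

Definition lcm_tuple (k : nat) (n : {ffun 'I_k -> nat}) : nat :=
  \big[lcmn/1%N]_i n i.

(* The set of tuples is finite, so this is a genuine sum (a sum over a set
   with infinitely many nonzero terms would be 0 by convention). *)
Definition lcm_sum (R : realType) (k : nat) (f : nat -> R[i]) (x : R) : R[i] :=
  \sum_(n \in @positive_tuples_in_ball R k x) f (lcm_tuple n).

Definition local_term (R : realType) (k : nat) (f : nat -> R[i]) (p : nat)
    (nu : {ffun 'I_k -> nat}) : R[i] :=
  f (p ^ \max_i nu i)%N / p%:R ^+ (\sum_i nu i).

(* summability.sum is the limit of the finite partial sums, along the finite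
   subsets of the index type directed by inclusion. *)
Definition local_factor (R : realType) (k : nat) (f : nat -> R[i]) (p : nat) :
    R[i] :=
  (1 - p%:R^-1) ^+ k * summability.sum (local_term (k := k) f p).

Definition euler_partial (R : realType) (k : nat) (f : nat -> R[i]) (N : nat) :
    R[i] :=
  \prod_(p < N | prime p) local_factor k f p.

Definition euler_constant (R : realType) (k : nat) (f : nat -> R[i]) : R[i] :=
  lim (euler_partial k f @ \oo).

(* Main.v *)
Require Import Defs.
From mathcomp Require Import finmap.
From mathcomp Require Import all_boot all_order all_algebra.
From mathcomp Require Import all_classical all_reals all_analysis.
From mathcomp.analysis.showcase Require summability.
From mathcomp Require Import complex.
From mathcomp Require Import ring lra zify.
Import Order.TTheory GRing.Theory Num.Theory.
Import numFieldNormedType.Exports.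
Local Open Scope classical_set_scope.
Local Open Scope complex_scope.
Local Open Scope ring_scope.

(** Fix a prime p and let h(p^a) = f(p^a) - f(p^(a-1)).  Telescoping and
    inclusion-exclusion over the coordinates give, for exponents nu_1..nu_k,

      f(p^max nu) = 1 + sum_(a >= 1) h(p^a) sum_(T nonempty)
                          (-1)^(|T|+1) prod_(i in T) [a <= nu_i].

    Multiplying over the primes p < N and distributing the product writes
    f([n_1,..,n_k]) as a sum over systems phi, which choose for each prime
    either nothing or a pair (a, T), of a coefficient times the indicator that
    d_i(phi) | n_i for all i, where d_i(phi) is the product of the p^a over the
    primes whose T contains i (lcm_expansion).  Summing over the ball, the sum
    of the theorem becomes a sum over phi of the coefficient times the number
    of lattice points of the ball in a sublattice of positive vectors
    (lcm_sum_systems).  Put y = sqrt x and let v_k be the volume V_k / 2^k of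
    an orthant of the unit ball.  That count is v_k y^k / prod d_i up to an
    error of at most y^k / prod d_i * sum_i min(1, d_i/y)
    (lattice_count_bounds).

    With m(phi) the product of all the chosen p^a one has d_i <= m <= prod d_i
    as long as the coefficient of phi does not vanish, so for 0 <= s <= 1 the
    error is at most k y^(k-s) m^(s-1).  For s = 1/2 - d, summing this against
    the coefficients gives the product over p of
    1 + O(p^(-1/2) p^(s-1) + p^(2(s-1))) = 1 + O(p^(-1-d)), which is bounded
    uniformly in N and in the bound V on the exponents a (euler_product_le).
    Here |f(p) - 1| = O(p^(-1/2)) is what makes the exponent 1/2 - d
    accessible.

    Resummed, the main terms are v_k y^k times the product over p < N of
    1 + sum_(a <= V) h(p^a) (1 - (1 - p^(-a))^k), which tends to the local
    factor as V grows (cvg_local_factor).  Hence for every N > y the sum of the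
    theorem differs from v_k y^k times the N-th partial Euler product by
    O(y^(k - 1/2 + d)), uniformly in N (lcm_sum_euler_partial).  The
    convergence of the Euler product is a consequence of this uniformity: two
    partial products with N, N' > y approximate the same quantity, so they
    differ by O(y^(-1/2 + d)) (cvg_euler_partial).

    The lattice point count is an induction on the dimension, summing over
    one coordinate at a time, which produces v_(k+1) = v_k I_k with I_k the
    integral of (1 - t^2)^(k/2) over [0, 1].  The Wallis-type relation
    I_k I_(k+1) = pi / (2(k+2)), the functional equation of Gamma, and the
    values Gamma(1) = 1, Gamma(3/2) = sqrt pi / 2 identify v_k with
    pi^(k/2) / (2^k Gamma(k/2 + 1)) (ball_volumeE). *)

Set Implicit Arguments.
Unset Strict Implicit.
Unset Printing Implicit Defensive.

(** * Powers of the semicircle *)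

(** The primitive vanishing at 0 of (1 - t^2)^(k/2) on [0, 1], given in closed
    form by the reduction formula in steps of two, so that the integrals
    needed below are values of this function at 1. *)
Fixpoint cap_primitive (R : realType) (k : nat) (t : R) : R :=
  match k with
  | 0 => t
  | 1 => (asin t + t * Num.sqrt (1 - t ^+ 2)) / 2
  | (k'.+1 as k1).+1 =>
      (t * Num.sqrt (1 - t ^+ 2) ^+ k'.+2 + k'.+2%:R * cap_primitive k' t)
        / k'.+3%:R
  end.

Lemma cap_primitiveSS (R : realType) k (t : R) :
  cap_primitive k.+2 t =
  (t * Num.sqrt (1 - t ^+ 2) ^+ k.+2 + k.+2%:R * cap_primitive k t) / k.+3%:R.
Proof. by []. Qed.

(** All quantities indexed by the dimension obey recursions in steps of two,
    with separate initial values for even and odd k. *)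
Lemma nat_ind2 (P : nat -> Prop) :
  P 0%N -> P 1%N -> (forall k, P k -> P k.+2) -> forall k, P k.
Proof.
move=> P0 P1 PSS k; suff: P k /\ P k.+1 by case.
by elim: k => [|k [Pk Pk1]]; split=> //; exact: PSS.
Qed.

Lemma is_derive_semicircle (R : realType) (t : R) : -1 < t < 1 ->
  is_derive t 1 (fun u : R => Num.sqrt (1 - u ^+ 2))
    (- t / Num.sqrt (1 - t ^+ 2)).
Proof.
move=> t1; have pos : 0 < 1 - t ^+ 2 by nra.
have s0 : Num.sqrt (1 - t ^+ 2) != 0 by rewrite gt_eqF // sqrtr_gt0.
have d1 : is_derive t 1 (fun u : R => 1 - u ^+ 2) (- (2 * t)).
  apply: is_derive_eq.
  rewrite /GRing.scale /=; ring.
have := @is_derive1_comp R _ _ t _ _ (is_derive1_sqrt pos) d1.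
move=> /is_derive_eq; apply.
field. by rewrite s0.
Qed.

(** With w = sqrt (1 - t^2), the derivative of t w^(k+2) is
    (k+3) w^(k+2) - (k+2) w^k because t^2 = 1 - w^2. *)
Lemma is_derive_cap_primitive (R : realType) k (t : R) : -1 < t < 1 ->
  is_derive t 1 (cap_primitive k) (Num.sqrt (1 - t ^+ 2) ^+ k).
Proof.
move=> t1; have pos : 0 < 1 - t ^+ 2 by nra.
have s0 : Num.sqrt (1 - t ^+ 2) != 0 by rewrite gt_eqF // sqrtr_gt0.
have ss : Num.sqrt (1 - t ^+ 2) ^+ 2 = 1 - t ^+ 2 by rewrite sqr_sqrtr // ltW.
have ds := is_derive_semicircle t1.
elim/nat_ind2: k => [||k IH].
- exact: is_derive_id.
- have da := is_derive1_asin t1.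
  apply: (@is_derive_eq _ _ _ (fun u => (asin u + u * Num.sqrt (1 - u ^+ 2)) / 2)).
  rewrite /GRing.scale /= expr1 mulr1.
  apply: (mulfI s0).
  field: ss. by rewrite s0.
- rewrite (_ : cap_primitive k.+2 = k.+3%:R^-1 *: (id * (fun u : R =>
      Num.sqrt (1 - u ^+ 2)) ^+ k.+2 + k.+2%:R *: cap_primitive k)); last first.
    by apply/funext => u; rewrite cap_primitiveSS mulrC !fctE.
  have dM := is_deriveM (is_derive_id t 1) (is_deriveX k.+2 ds).
  have := is_deriveZ k.+3%:R^-1 (is_deriveD dM (is_deriveZ k.+2%:R IH)).
  move=> /is_derive_eq; apply.
  rewrite !fctE /GRing.scale /= !mulr1 ![_ ^+ k.+2]exprS ![_ ^+ k.+1]exprS.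
  have c0 : k.+2%:R + 1 != 0 :> R by rewrite natr1 pnatr_eq0.
  rewrite -[k.+3%:R]natr1; move: ss s0 c0.
  move: (k.+2%:R : R) (Num.sqrt _) (_ ^+ k) => c s P ss s0 c0.
  by field: ss; rewrite s0 c0.
Qed.

Lemma continuous_asin01 (R : realType) : {within `[0, 1 : R], continuous asin}.
Proof.
have p0 : 0 <= pi / 2 :> R by rewrite divr_ge0 ?pi_ge0.
have := @segment_can_le_continuous R 0 (pi / 2) sin asin p0.
rewrite sin0 sin_pihalf; apply; first by apply/continuous_subspaceT/continuous_sin.
move=> x; rewrite in_itv/= => /andP[x0 x1]; apply: sinK.
by rewrite in_itv/= x1 andbT (le_trans _ x0)// oppr_le0.
Qed.

Lemma continuous_cap_primitive (R : realType) k :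
  {within `[0, 1 : R], continuous (cap_primitive k)}.
Proof.
have cs : continuous (fun u : R => Num.sqrt (1 - u ^+ 2)).
  move=> u; apply: continuous_comp; last exact: sqrt_continuous.
  by apply: cvgB; [exact: cvg_cst | exact: exprn_continuous].
elim/nat_ind2: k => [||k IH].
- by apply: (continuous_subspaceT (f := fun u : R => u)) => u; exact: cvg_id.
- move=> x; apply: cvgMl; apply: cvgD; first exact: continuous_asin01.
  apply: (continuous_subspaceT (f := fun u : R => u * Num.sqrt (1 - u ^+ 2))).
  by move=> u; apply: cvgM; [exact: cvg_id | exact: cs].
- move=> x; apply: cvgMl; apply: cvgD; last by apply: cvgMr; exact: IH.
  apply: (continuous_subspaceT (f := fun u : R => u * Num.sqrt (1 - u ^+ 2) ^+ k.+2)).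
  move=> u; apply: cvgM; first exact: cvg_id.
  by apply: (cvg_comp _ (fun y : R => y ^+ k.+2) (cs u)); exact: exprn_continuous.
Qed.

Lemma semicircle_le (R : realType) (u t : R) : 0 <= u -> u <= t ->
  Num.sqrt (1 - t ^+ 2) <= Num.sqrt (1 - u ^+ 2).
Proof. by move=> u0 ut; rewrite ler_wsqrtr // lerB // ler_sqr ?nnegrE //; lra. Qed.

(** The mean value theorem and the monotonicity of the semicircle replace the
    comparison of a Riemann sum with its integral. *)
Lemma cap_primitive_increment (R : realType) k (a b : R) :
  0 <= a -> a <= b -> b <= 1 ->
  (b - a) * Num.sqrt (1 - b ^+ 2) ^+ k <= cap_primitive k b - cap_primitive k a
    <= (b - a) * Num.sqrt (1 - a ^+ 2) ^+ k.
Proof.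
move=> a0; rewrite le_eqVlt => /orP[/eqP <- _|ab b1].
  by rewrite !subrr !mul0r lexx.
have [] := @MVT R (cap_primitive k) (fun t => Num.sqrt (1 - t ^+ 2) ^+ k) a b ab.
- move=> x; rewrite in_itv/= => /andP[ax xb]; apply: is_derive_cap_primitive.
  by apply/andP; split; lra.
- apply: continuous_subspaceW (@continuous_cap_primitive R k) => x /=.
  by rewrite !in_itv/= => /andP[ax xb]; apply/andP; split; lra.
move=> c; rewrite in_itv/= => /andP[ac cb] ->; rewrite [_ * (b - a)]mulrC.
have ba : 0 <= b - a by lra.
by apply/andP; split; apply: ler_wpM2l => //; apply: lerXn2r;
   rewrite ?nnegrE ?sqrtr_ge0 //; apply: semicircle_le; lra.
Qed.

Lemma cap_primitive0 (R : realType) k : cap_primitive k (0 : R) = 0.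
Proof.
elim/nat_ind2: k => [||k IH] //.
- rewrite /= mul0r addr0 -[X in asin X]sin0 sinK ?mul0r // in_itv/=.
  by rewrite divr_ge0 ?pi_ge0 // oppr_le0 divr_ge0 ?pi_ge0.
- by rewrite cap_primitiveSS IH mul0r mulr0 addr0 mul0r.
Qed.

Lemma cap_primitive1_0 (R : realType) : cap_primitive 0 (1 : R) = 1.
Proof. by []. Qed.

Lemma cap_primitive1_1 (R : realType) : cap_primitive 1 (1 : R) = pi / 4.
Proof.
rewrite /= expr1n subrr sqrtr0 mulr0 addr0 -[X in asin X]sin_pihalf sinK.
  by field.
rewrite in_itv/= lexx andbT (@le_trans _ _ 0) ?oppr_le0 //;
  by rewrite divr_ge0 ?pi_ge0.
Qed.

Lemma cap_primitive1_SS (R : realType) k :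
  cap_primitive k.+2 (1 : R) = k.+2%:R / k.+3%:R * cap_primitive k 1.
Proof.
rewrite cap_primitiveSS expr1n subrr sqrtr0 expr0n mulr0 add0r.
by rewrite mulrAC.
Qed.

Lemma cap_primitive1_itv (R : realType) k : 0 <= cap_primitive k (1 : R) <= 1.
Proof.
have := @cap_primitive_increment R k 0 1 (lexx _) ler01 (lexx _).
rewrite cap_primitive0 !subr0 !mul1r expr0n /= subr0 sqrtr1 !expr1n.
move=> /andP[h ->]; rewrite andbT (le_trans _ h) // exprn_ge0 // sqrtr_ge0.
Qed.

(** Wallis: the reduction formula multiplies both the left and the right side
    by (k+2)/(k+3) when k increases by one. *)
Lemma cap_primitive1_mulS (R : realType) k :
  cap_primitive k (1 : R) * cap_primitive k.+1 1 = pi / (2 * k.+2%:R).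
Proof.
elim: k => [|k IH]; first by rewrite cap_primitive1_0 cap_primitive1_1; field.
rewrite cap_primitive1_SS mulrCA [_ * cap_primitive k 1]mulrC IH.
have h2 : k.+2%:R != 0 :> R by rewrite pnatr_eq0.
have h3 : k.+3%:R != 0 :> R by rewrite pnatr_eq0.
by move: (k.+2%:R : R) (k.+3%:R : R) h2 h3 => x y x0 y0; field; rewrite x0 y0.
Qed.

(** The volume of the positive orthant of the unit ball, by slicing along the
    last coordinate: the slice at height t has volume v_k (1 - t^2)^(k/2). *)
Fixpoint orthant_volume (R : realType) (k : nat) : R :=
  if k is k'.+1 then orthant_volume R k' * cap_primitive k' 1 else 1.

Lemma orthant_volume_itv (R : realType) k : 0 <= orthant_volume R k <= 1.
Proof.
elim: k => [|k /andP[v0 v1]] /=; first by rewrite ler01 lexx.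
have /andP[c0 c1] := @cap_primitive1_itv R k.
by rewrite mulr_ge0 //= mulr_ile1.
Qed.

Lemma orthant_volumeSS (R : realType) k :
  orthant_volume R k.+2 = orthant_volume R k * (pi / (2 * k.+2%:R)).
Proof. by rewrite -cap_primitive1_mulS /= mulrA. Qed.

(** A decreasing function bounded by 1: the right-endpoint sum with step h
    misses at most the first cell, whose contribution is at most min(1, h).
    The truncation at 1 of the last abscissa accounts for the incomplete
    last cell, and covers the case h > 1 where M = 0. *)
Lemma cap_riemann_sum (R : realType) k (h : R) (M : nat) : 0 < h ->
  M%:R * h <= 1 < M.+1%:R * h ->
  cap_primitive k 1 - Num.min 1 h
    <= \sum_(1 <= m < M.+1) h * Num.sqrt (1 - (m%:R * h) ^+ 2) ^+ k
    <= cap_primitive k 1.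
Proof.
move=> h0 /andP[Mh SMh].
have mh m : (m <= M)%N -> m%:R * h <= 1.
  by move=> mM; apply: le_trans Mh; rewrite ler_pM2r // ler_nat.
have mh0 m : 0 <= m%:R * h by rewrite mulr_ge0 // ltW.
have stepE m : m.+1%:R * h = m%:R * h + h by rewrite -natr1 mulrDl mul1r.
have incr (a b : R) : 0 <= a -> a <= b -> b <= 1 -> cap_primitive k a <= cap_primitive k b.
  move=> a0 ab b1; have /andP[hl _] := cap_primitive_increment k a0 ab b1.
  rewrite -subr_ge0 (le_trans _ hl) // mulr_ge0 ?subr_ge0 // exprn_ge0.
apply/andP; split.
(* Truncating the abscissas at 1 makes the cells cover [min(1, h), 1]. *)
- pose c m : R := Num.min 1 (m%:R * h).
  have -> : cap_primitive k 1 = cap_primitive k (c M.+1).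
    by rewrite /c min_l // ltW.
  have c1le : cap_primitive k (c 1%N) <= Num.min 1 h.
    have c0 : 0 <= c 1%N by rewrite le_min ler01 mh0.
    have c1 : c 1%N <= 1 by rewrite ge_min lexx.
    have /andP[_] := cap_primitive_increment k (lexx 0) c0 c1.
    rewrite cap_primitive0 !subr0 expr0n /= subr0 sqrtr1 expr1n mulr1.
    by rewrite /c mul1r.
  apply: le_trans (lerB (lexx _) c1le) _.
  rewrite -(@telescope_sumr _ 1 M.+1 (fun m => cap_primitive k (c m))) //.
  rewrite !big_nat; apply: ler_sum => m /andP[m1 mM].
  have cm : c m = m%:R * h by rewrite /c min_r // mh.
  have cS : c m <= c m.+1.
    by rewrite cm /c le_min mh //= ler_pM2r // ler_nat.
  have c0 : 0 <= c m by rewrite cm mh0.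
  have c1 : c m.+1 <= 1 by rewrite ge_min lexx.
  have /andP[_] := cap_primitive_increment k c0 cS c1.
  move=> /le_trans; apply; rewrite cm ler_wpM2r ?exprn_ge0 ?sqrtr_ge0 //.
  by rewrite lerBlDr [h + _]addrC -stepE /c ge_min lexx orbT.
- apply: (@le_trans _ _ (cap_primitive k (M%:R * h))); last exact: incr.
  have -> : cap_primitive k (M%:R * h) = cap_primitive k (M%:R * h) - cap_primitive k (0%:R * h).
    by rewrite mul0r cap_primitive0 subr0.
  rewrite big_add1 -(@telescope_sumr _ 0 M (fun m => cap_primitive k (m%:R * h))) //.
  rewrite !big_nat; apply: ler_sum => m /andP[_ mM].
  have le1 : m%:R * h <= m.+1%:R * h by rewrite ler_pM2r // ler_nat.
  have /andP[hl _] := cap_primitive_increment k (mh0 m) le1 (mh _ mM).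
  by apply: le_trans hl; rewrite {2}stepE addrAC subrr add0r.
Qed.

(** * Lattice points in an orthant of a ball *)

Definition ffun_cons (T : Type) k (a : T) (g : {ffun 'I_k -> T}) : {ffun 'I_k.+1 -> T} :=
  [ffun i => oapp g a (unlift ord0 i)].

Lemma sum_ffunS (V : nmodType) (T : finType) k (F : {ffun 'I_k.+1 -> T} -> V) :
  \sum_n F n = \sum_a \sum_g F (ffun_cons a g).
Proof.
rewrite pair_bigA /= (reindex (fun u : T * {ffun 'I_k -> T} => ffun_cons u.1 u.2)) //=.
exists (fun n : {ffun 'I_k.+1 -> T} => (n ord0, [ffun i => n (lift ord0 i)])).
- move=> [a g] _ /=; rewrite ffunE unlift_none /=; congr pair.
  by apply/ffunP => i; rewrite !ffunE liftK.
- move=> n _; apply/ffunP => i; rewrite ffunE /=.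
  by case: unliftP => [j|] -> //=; rewrite ffunE.
Qed.

(** Real-valued, to be compared with a volume.  The range 'I_B of the
    coordinates has no effect once B exceeds sqrt z. *)
Definition lattice_count (R : realType) k (d : 'I_k -> nat) (B : nat) (z : R) : R :=
  \sum_(n : {ffun 'I_k -> 'I_B})
    ([forall i, (0 < n i)%N && (d i %| n i)%N]
      && (\sum_i (n i)%:R ^+ 2 <= z)%R)%:R.

Lemma lattice_count0 (R : realType) (d : 'I_0 -> nat) B (z : R) :
  lattice_count d B z = (0 <= z)%R%:R.
Proof.
rewrite /lattice_count (eq_bigr (fun=> (0 <= z)%R%:R)); last first.
  move=> n _; rewrite big_ord0.
  suff -> : [forall i : 'I_0, (0 < n i)%N && (d i %| n i)%N] by [].
  by apply/forallP => -[].
by rewrite sumr_const card_ffun !card_ord expn0.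
Qed.

Lemma lattice_countS (R : realType) k (d : 'I_k.+1 -> nat) B (z : R) :
  lattice_count d B z =
  \sum_(m < B | (0 < m)%N && (d ord0 %| m)%N)
    lattice_count (d \o lift ord0) B (z - m%:R ^+ 2).
Proof.
rewrite /lattice_count sum_ffunS [RHS]big_mkcond /=; apply: eq_bigr => m _.
case: ifPn => mP; last first.
  rewrite big1 // => g _; suff -> : [forall i,
      (0 < ffun_cons m g i)%N && (d i %| ffun_cons m g i)%N] = false by [].
  apply/forallP => /(_ ord0).
  by rewrite ffunE unlift_none /= (negbTE mP).
apply: eq_bigr => g _; congr (nat_of_bool (_ && _))%:R.
  apply/forallP/forallP => [h i|h i].
    by have := h (lift ord0 i); rewrite ffunE liftK.
  rewrite ffunE; case: unliftP => [j|] -> /=; [exact: h | exact: mP].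
rewrite big_ord_recl ffunE unlift_none /= [RHS]lerBrDl.
by under eq_bigr do rewrite ffunE liftK.
Qed.

Lemma lattice_count_lt0 (R : realType) k (d : 'I_k -> nat) B (z : R) :
  z < 0 -> lattice_count d B z = 0.
Proof.
move=> z0; apply: big1 => n _; rewrite [X in _ && X]leNgt.
by rewrite (lt_le_trans z0) ?sumr_ge0 ?andbF // => i _; rewrite sqr_ge0.
Qed.

(** The substitution n = d m, for summands supported on n <= d M. *)
Lemma sum_multiples (V : nmodType) (d B M : nat) (F : nat -> V) :
  (0 < d)%N -> (d * M < B)%N ->
  (forall m, (M < m)%N -> F (d * m)%N = 0) ->
  \sum_(m < B | (0 < m)%N && (d %| m)%N) F m = \sum_(1 <= m < M.+1) F (d * m)%N.
Proof.
move=> d0 MB F0.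
rewrite -(big_mkord (fun m => (0 < m)%N && (d %| m)%N) F).
have -> : \sum_(1 <= m < M.+1) F (d * m)%N =
    \sum_(1 <= m < M.+1) \sum_(0 <= j < B | j == (d * m)%N) F j.
  rewrite !big_nat; apply: eq_bigr => m /andP[_ mM]; rewrite big_nat1_eq.
  by rewrite ifT //; nia.
transitivity (\sum_(1 <= m < M.+1)
    \sum_(0 <= j < B) if j == (d * m)%N then F j else 0); last first.
  by apply: eq_bigr => m _; rewrite -big_mkcond.
rewrite exchange_big /= big_mkcond /=; apply: eq_bigr => m _.
case: ifPn => [/andP[m0 /dvdnP[q mE]]|mN]; last first.
  rewrite big_nat_cond big1 // => i /andP[/andP[i1 _] _]; case: eqP => // mE.
  by move: mN; rewrite mE dvdn_mulr // muln_gt0 d0 i1.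
rewrite -big_mkcond /= (eq_bigl (fun i => i == q)); last first.
  by move=> i; rewrite mE mulnC eqn_pmul2l // eq_sym.
rewrite big_nat1_eq; case: ifPn => // qM; rewrite mE mulnC F0 //.
by nia.
Qed.

(** Slices of a ball of radius y have radius y s with s <= 1, and the relative
    error of a slice is larger; the factor s^k coming from its volume
    compensates this as soon as k > 0. *)
Lemma shrink_min (R : realType) k (s y a : R) : (0 < k)%N -> 0 <= s <= 1 -> 0 < y -> 0 <= a ->
  s ^+ k * Num.min 1 (a / (y * s)) <= Num.min 1 (a / y).
Proof.
case: k => // k _ /andP[s0 s1] y0 a0.
have [->|sn0] := eqVneq s 0.
  by rewrite expr0n mul0r le_min ler01 divr_ge0 // ltW.
have sp : 0 < s by rewrite lt_neqAle eq_sym sn0.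
have m0 : 0 <= Num.min 1 (a / (y * s)).
  by rewrite le_min ler01 divr_ge0 // mulr_ge0 // ltW.
have sk1 : s ^+ k <= 1 by rewrite exprn_ile1.
rewrite exprSr -mulrA (le_trans (ler_piMl _ sk1)) // ?mulr_ge0 //.
rewrite le_min; apply/andP; split.
  by rewrite mulr_ile1 // ge_min lexx.
apply: (@le_trans _ _ (s * (a / (y * s)))); first by rewrite ler_wpM2l // ge_min lexx orbT.
by rewrite le_eqVlt; apply/orP; left; apply/eqP; field; rewrite sn0 gt_eqF.
Qed.

(** Induction on k: the slices n_0 = d_0 m are balls of radius y s(m h) with
    h = d_0 / y, the main terms form a Riemann sum of (1 - t^2)^(k/2) of step
    h, and the new error term min(1, h) is that of this sum.  The upper bound
    has no error term because the boxes with upper corner at the lattice points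
    are disjoint and contained in the ball. *)
Lemma lattice_count_bounds (R : realType) k (d : 'I_k -> nat) B (y : R) :
  (forall i, (0 < d i)%N) -> 0 <= y < B%:R ->
  y ^+ k / (\prod_i (d i)%:R)
      * (orthant_volume R k - \sum_i Num.min 1 ((d i)%:R / y))
    <= lattice_count d B (y ^+ 2)
    <= y ^+ k / (\prod_i (d i)%:R) * orthant_volume R k.
Proof.
elim: k d y => [|k IH] d y d0 /andP[y0 yB].
  by rewrite lattice_count0 !big_ord0 sqr_ge0 /= subr0 invr1 !mulr1 lexx.
have := y0; rewrite le_eqVlt => /predU1P[y00|yp].
  rewrite -y00 lattice_countS [X in _ <= X <= _]big1 ?expr0n /= ?mul0r ?lexx //.
  move=> m /andP[m0 _]; apply: lattice_count_lt0.
  by rewrite sub0r oppr_lt0 exprn_gt0 // ltr0n.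
set d' := d \o lift ord0; set c : R := (d ord0)%:R.
have c0 : 0 < c by rewrite ltr0n.
pose h := c / y; have h0 : 0 < h by rewrite divr_gt0.
have yE : y = c / h by rewrite /h invf_div mulrC divfK // gt_eqF.
pose M := Num.truncn (y / c).
have /andP[Mle ltM] : M%:R <= y / c < M.+1%:R by apply/truncn_itv/divr_ge0 => //; apply: ltW.
have Mh : M%:R * h <= 1 < M.+1%:R * h.
  by rewrite /h !mulrA ler_pdivrMr // ltr_pdivlMr // mul1r -ler_pdivlMr // -ltr_pdivrMr // Mle ltM.
have P0 : 0 < \prod_i (d' i)%:R :> R by apply: prodr_gt0 => i _; rewrite ltr0n; apply: d0.
set P := \prod_i (d' i)%:R in P0.
have PE : \prod_i (d i)%:R = c * P by rewrite big_ord_recl.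
pose s m := Num.sqrt (1 - (m%:R * h) ^+ 2).
have s01 m : 0 <= s m <= 1.
  by rewrite sqrtr_ge0 -[X in _ <= X]sqrtr1 ler_wsqrtr // gerBl sqr_ge0.
have sE m : (m <= M)%N -> y ^+ 2 - (d ord0 * m)%:R ^+ 2 = (y * s m) ^+ 2.
  move=> mM; have mh1 : m%:R * h <= 1.
    by case/andP: Mh => + _; apply: le_trans; rewrite ler_pM2r // ler_nat.
  have mh0 : 0 <= m%:R * h by rewrite mulr_ge0 // ltW.
  rewrite exprMn sqr_sqrtr; last by rewrite subr_ge0 expr_le1.
  by rewrite natrM -/c {1 2}yE; field; rewrite gt_eqF.
have yc : y / c = h^-1 by rewrite /h invf_div.
have -> : lattice_count d B (y ^+ 2) =
    \sum_(1 <= m < M.+1) lattice_count d' B ((y * s m) ^+ 2).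
  rewrite lattice_countS.
  rewrite (@sum_multiples _ _ _ M (fun m => lattice_count d' B (y ^+ 2 - m%:R ^+ 2))) //.
  - by rewrite !big_nat; apply: eq_bigr => m /andP[_ mM]; rewrite sE.
  - rewrite -(ltr_nat R) natrM -/c (le_lt_trans _ yB) //.
    by rewrite mulrC -ler_pdivlMr.
  - move=> m Mm; apply: lattice_count_lt0; rewrite subr_lt0 ltr_sqr ?nnegrE ?ler0n //.
    rewrite natrM -/c mulrC -ltr_pdivrMr // (lt_le_trans ltM) // ler_nat //.
have /andP[v0 v1] := @orthant_volume_itv R k.
have /andP[rl ru] := cap_riemann_sum k h0 Mh.
have dE i : (d' i)%:R = (d (lift ord0 i))%:R :> R by [].
have bnd m : 0 <= y * s m < B%:R.
  have /andP[sm0 sm1] := s01 m; rewrite mulr_ge0 //=.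
  by rewrite (le_lt_trans _ yB) // ler_piMr.
rewrite PE exprSr big_ord_recl -/c -/h.
have -> : y ^+ k * y / (c * P) = y ^+ k / P / h.
  by rewrite /h; field; rewrite !gt_eqF.
have Y0 : 0 <= y ^+ k / P / h by rewrite !divr_ge0 ?exprn_ge0 // ltW.
have Yk0 : 0 <= y ^+ k / P by rewrite divr_ge0 ?exprn_ge0 // ltW.
apply/andP; split.
- set mu := \sum_(i < k) _.
  have mu0 : 0 <= mu.
    by apply: sumr_ge0 => i _; rewrite le_min ler01 divr_ge0 ?ler0n.
  apply: (@le_trans _ _ (\sum_(1 <= m < M.+1) y ^+ k / P * (orthant_volume R k * s m ^+ k - mu))).
    rewrite -mulr_sumr sumrB -mulr_sumr sumr_const_nat subSS subn0 -mulr_natl -mulrA.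
    apply: ler_wpM2l => //; rewrite mulrC ler_pdivrMr // mulrBl /=.
    rewrite opprD addrA; apply: lerB.
      rewrite -mulrA [(\sum_(_ <= _ < _) _) * h]mulrC mulr_sumr.
      apply: le_trans (ler_wpM2l v0 rl); rewrite mulrBr lerB // ler_piMl //.
      by rewrite le_min ler01 ltW.
    rewrite mulrAC ler_piMl //; by case/andP: Mh.
  rewrite !big_nat; apply: ler_sum => m /andP[_ mM].
  have /andP[+ _] := IH d' (y * s m) (fun i => d0 _) (bnd m).
  apply: le_trans; rewrite -/P.
  set S := \sum_(i < k) _.
  have -> : (y * s m) ^+ k / P * (orthant_volume R k - S)
      = y ^+ k / P * (orthant_volume R k * s m ^+ k - s m ^+ k * S).
    by rewrite exprMn; ring.
  apply: ler_wpM2l => //; rewrite lerB // mulr_sumr; apply: ler_sum => i _.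
  by apply: shrink_min => //; exact: leq_ltn_trans (ltn_ord i).
- apply: (@le_trans _ _ (\sum_(1 <= m < M.+1) y ^+ k / P * (orthant_volume R k * s m ^+ k))).
    rewrite !big_nat; apply: ler_sum => m /andP[_ mM].
    have /andP[_] := IH d' (y * s m) (fun i => d0 _) (bnd m).
    move=> /le_trans; apply; rewrite -/P exprMn le_eqVlt; apply/orP; left.
    by apply/eqP; ring.
  rewrite -!mulr_sumr -[leRHS]mulrA; apply: ler_wpM2l => //.
  rewrite mulrCA; apply: ler_wpM2l => //.
  by rewrite mulrC ler_pdivlMr // mulrC mulr_sumr.
Qed.

(** * The Gamma function at half-integers *)

(** This agrees on t > 0 with the integrand of Gamma(k/2 + 1); written with a
    natural power of sqrt t it is continuous on the whole line. *)
Definition gamma_integrand (R : realType) (k : nat) (t : R) : R :=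
  Num.sqrt t ^+ k * expR (- t).

Definition gamma_partial (R : realType) (k : nat) (b : R) : R :=
  \int[lebesgue_measure]_(t in `[0, b]) gamma_integrand k t.

Lemma continuous_expRN (R : realType) : continuous (fun t : R => expR (- t)).
Proof.
move=> t; apply: (cvg_comp (fun t : R => - t) expR); last exact: continuous_expR.
by apply: cvgN; exact: cvg_id.
Qed.

Lemma continuous_gamma_integrand (R : realType) k :
  continuous (@gamma_integrand R k).
Proof.
move=> t; apply: cvgM; last exact: continuous_expRN.
apply: (cvg_comp _ (fun y : R => y ^+ k) (@sqrt_continuous R t)).
exact: exprn_continuous.
Qed.

Lemma Rintegral_continuous_FTC2 (R : realType) (f F : R -> R) (b : R) : 0 < b ->
  continuous f -> {within `[0, b], continuous F} ->
  (forall t, 0 < t < b -> is_derive t 1 F (f t)) ->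
  \int[lebesgue_measure]_(t in `[0, b]) f t = F b - F 0.
Proof.
move=> b0 cf cF dF; rewrite /Rintegral.
rewrite (@continuous_FTC2 R f F 0 b) //.
- exact: continuous_subspaceT.
- move/(continuous_within_itvP _ b0) : cF => [_ c0 cb]; split=> //.
  by move=> t; rewrite in_itv/= => /dF/@ex_derive.
- move=> t; rewrite in_itv/= => /dF h; rewrite derive1E; exact: derive_val.
Qed.

Lemma integrable_gamma_integrand (R : realType) k (b : R) :
  lebesgue_measure.-integrable `[0, b] (EFin \o @gamma_integrand R k).
Proof.
apply: continuous_compact_integrable; first exact: segment_compact.
apply: continuous_subspaceT; exact: continuous_gamma_integrand.
Qed.

Lemma continuous_primitive (R : realType) (f : R -> R) (b : R) : 0 <= b ->
  continuous f ->
  {within `[0, b], continuous (fun x => \int[lebesgue_measure]_(t in `[0, x]) f t)}.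
Proof.
move=> b0 cf; apply: parameterized_integral_continuous => //.
apply: continuous_compact_integrable; first exact: segment_compact.
exact: continuous_subspaceT.
Qed.

Lemma is_derive_primitive (R : realType) (f : R -> R) (t : R) : 0 < t ->
  continuous f ->
  is_derive t 1 (fun x => \int[lebesgue_measure]_(t in `[0, x]) f t) (f t).
Proof.
move=> t0 cf.
have [] := @continuous_FTC1_closed R f 0 t (t + 1).
- by rewrite ltrDl.
- apply: continuous_compact_integrable; first exact: segment_compact.
  exact: continuous_subspaceT.
- exact: t0.
- exact: cf.
by move=> d <-; rewrite derive1E; apply: DeriveDef.
Qed.

Lemma is_derive_expRN (R : realType) (t : R) :
  is_derive t 1 (fun t : R => expR (- t)) (- expR (- t)).
Proof.
have := is_derive1_comp (is_derive_expR (- t)) (is_deriveN (is_derive_id t 1)).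
by move=> /is_derive_eq; apply; rewrite mulrN1.
Qed.

Lemma gamma_partial0 (R : realType) (b : R) : 0 < b ->
  gamma_partial 0 b = 1 - expR (- b).
Proof.
move=> b0; rewrite /gamma_partial.
pose F (t : R) := - expR (- t).
transitivity (F b - F 0); first apply: (Rintegral_continuous_FTC2 b0).
- exact: continuous_gamma_integrand.
- by apply: continuous_subspaceT => t; apply: cvgN; exact: continuous_expRN.
- move=> t _; have := is_deriveN (is_derive_expRN t).
  by move=> /is_derive_eq; apply; rewrite opprK /gamma_integrand expr0 mul1r.
- by rewrite /F oppr0 expR0 opprK addrC.
Qed.

Lemma is_derive_gamma_boundary (R : realType) k (t : R) : 0 < t ->
  is_derive t 1 (gamma_integrand k.+1)
    (k.+1%:R / 2 * (Num.sqrt t ^+ k / Num.sqrt t * expR (- t)) - gamma_integrand k.+1 t).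
Proof.
move=> t0; have s0 : Num.sqrt t != 0 by rewrite gt_eqF // sqrtr_gt0.
rewrite [X in is_derive _ _ X _](_ : _ =
    (Num.sqrt ^+ k.+1 : R -> R) * (fun u => expR (- u))); last first.
  by apply/funext => u; rewrite !fctE.
have := is_deriveM (is_deriveX k.+1 (is_derive1_sqrt t0)) (is_derive_expRN t).
move=> /is_derive_eq; apply.
rewrite !fctE /gamma_integrand /GRing.scale /= mulrN addrC; congr (_ - _).
by field.
Qed.

(** Integration by parts, as the statement that the right-hand side is a
    primitive of the integrand. *)
Lemma gamma_partialSS (R : realType) k (b : R) : 0 < b ->
  gamma_partial k.+2 b =
  k.+2%:R / 2 * gamma_partial k b - gamma_integrand k.+2 b.
Proof.
move=> b0; rewrite {1}/gamma_partial.
pose F (t : R) := k.+2%:R / 2 * gamma_partial k t - gamma_integrand k.+2 t.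
transitivity (F b - F 0); first apply: (Rintegral_continuous_FTC2 b0).
- exact: continuous_gamma_integrand.
- move=> t; apply: cvgB.
    apply: cvgMr; apply: continuous_primitive; first exact: ltW.
    exact: continuous_gamma_integrand.
  by apply: (continuous_subspaceT (f := gamma_integrand k.+2)) => u; exact: continuous_gamma_integrand.
- move=> t /andP[t0 _].
  have dp := is_derive_primitive t0 (@continuous_gamma_integrand R k).
  have := is_deriveB (is_deriveZ (k.+2%:R / 2) dp) (is_derive_gamma_boundary k.+1 t0).
  move=> /is_derive_eq; apply.
  have s0 : Num.sqrt t != 0 by rewrite gt_eqF // sqrtr_gt0.
  rewrite /GRing.scale /= /gamma_integrand exprSr mulfK //.
  by ring.
- rewrite /F /gamma_partial set_itv1 Rintegral_set1 /gamma_integrand sqrtr0.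
  by rewrite expr0n mul0r !mulr0 !subr0.
Qed.

Lemma integral0_gauss_itv (R : realType) (s : R) : 0 <= s ->
  0 <= gauss_integral_proof.integral0_gauss s <= s.
Proof.
move=> s0; rewrite gauss_integral_proof.integral0_gauss_ge0 /=.
have dg t : t \in `]0, s[ ->
    is_derive t 1 (@gauss_integral_proof.integral0_gauss R) (gauss_fun t).
  rewrite in_itv/= => /andP[t0 _].
  exact: (is_derive_primitive t0 (@continuous_gauss_fun R)).
have [t _] := MVT_segment s0 dg
  (continuous_primitive s0 (@continuous_gauss_fun R)).
rewrite {2}/gauss_integral_proof.integral0_gauss set_itv1 Rintegral_set1 !subr0 => ->.
by rewrite ler_piMl // gauss_fun_le1.
Qed.

(** At 0 the composition with sqrt is not differentiable, and continuity comes
    from 0 <= G(s) <= s for the Gaussian primitive G. *)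
Lemma continuous_integral0_gauss_sqrt (R : realType) (t : R) : 0 <= t ->
  {for t, continuous (fun t => gauss_integral_proof.integral0_gauss (Num.sqrt t))}.
Proof.
rewrite le_eqVlt => /predU1P[<-|t0].
  rewrite /prop_for /continuous_at sqrtr0 {2}/gauss_integral_proof.integral0_gauss.
  rewrite set_itv1 Rintegral_set1.
  apply: (@squeeze_cvgr _ _ _ _ (cst 0) Num.sqrt).
  - by near=> u; exact: integral0_gauss_itv (sqrtr_ge0 _).
  - exact: cvg_cst.
  - by have := @sqrt_continuous R 0; rewrite /continuous_at sqrtr0.
have s0 : 0 < Num.sqrt t by rewrite sqrtr_gt0.
have dg := is_derive_primitive s0 (@continuous_gauss_fun R).
have [dc _] := is_derive1_comp dg (is_derive1_sqrt t0).
by apply: differentiable_continuous; rewrite -derivable1_diffP.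
Unshelve. all: end_near. Qed.

(** The substitution t = u^2 followed by an integration by parts, again checked
    by differentiating the right-hand side. *)
Lemma gamma_partial1 (R : realType) (b : R) : 0 < b ->
  gamma_partial 1 b =
  gauss_integral_proof.integral0_gauss (Num.sqrt b) - gamma_integrand 1 b.
Proof.
move=> b0; rewrite {1}/gamma_partial.
pose F (t : R) :=
  gauss_integral_proof.integral0_gauss (Num.sqrt t) - gamma_integrand 1 t.
transitivity (F b - F 0); first apply: (Rintegral_continuous_FTC2 b0).
- exact: continuous_gamma_integrand.
- move=> t; apply: cvgB; last first.
    by apply: (continuous_subspaceT (f := gamma_integrand 1)) => u; exact: continuous_gamma_integrand.
  apply: (continuous_in_subspaceT (f := fun t =>
    gauss_integral_proof.integral0_gauss (Num.sqrt t))) => u.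
  by rewrite inE /= in_itv/= => /andP[u0 _]; exact: continuous_integral0_gauss_sqrt.
- move=> t /andP[t0 _].
  have s0 : 0 < Num.sqrt t by rewrite sqrtr_gt0.
  have dg := is_derive_primitive s0 (@continuous_gauss_fun R).
  have := is_deriveB (is_derive1_comp dg (is_derive1_sqrt t0)) (is_derive_gamma_boundary 0 t0).
  move=> /is_derive_eq; apply.
  rewrite /gauss_fun /gamma_integrand sqr_sqrtr; last exact: ltW.
  by field; rewrite gt_eqF.
- rewrite /F /gauss_integral_proof.integral0_gauss sqrtr0 set_itv1 Rintegral_set1.
  by rewrite /gamma_integrand sqrtr0 expr0n mul0r subrr subr0.
Qed.

Lemma cvg_gamma_integrand (R : realType) k :
  gamma_integrand k (n%:R : R) @[n --> \oo] --> 0.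
Proof.
pose c : R := 2 * (k.+1)`!%:R.
have h : c * (harmonic n : R) @[n --> \oo] --> 0.
  by rewrite -[X in _ --> X](mulr0 c); apply: cvgMr; exact: cvg_harmonic.
apply: (@squeeze_cvgr _ _ _ _ (cst 0) _ _ _ _ _ h); last exact: cvg_cst.
near=> n; have n1 : (1 <= n)%N by near: n; exact: nbhs_infty_ge.
have n0 : 0 < n%:R :> R by rewrite ltr0n.
rewrite /gamma_integrand /= mulr_ge0 ?exprn_ge0 ?expR_ge0 //=.
have n1' : 1 <= n%:R :> R by rewrite ler1n.
have sn : Num.sqrt n%:R <= n%:R :> R.
  have : n%:R <= n%:R ^+ 2 :> R by rewrite expr2 ler_peMl // ltW.
  by move/ler_wsqrtr; rewrite sqrtr_sqr ger0_norm // ltW.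
apply: (@le_trans _ _ (n%:R ^+ k * expR (- n%:R))).
  by rewrite ler_wpM2r ?expR_ge0 // lerXn2r ?nnegrE // ?sqrtr_ge0 ?ltW.
have e0 : 0 < expR (n%:R) :> R := expR_gt0 _.
have F0 : 0 < (k.+1)`!%:R :> R by rewrite ltr0n fact_gt0.
have := expR_ge1Dxn k (ltW n0).
rewrite expRN ler_pdivrMr // => h1.
(* The exponential series gives n^k exp(-n) <= (k+1)! / n <= 2 (k+1)! / (n+1). *)
have h2 : n%:R ^+ k.+1 / (k.+1)`!%:R <= expR n%:R :> R.
  by apply: le_trans h1; rewrite lerDr ler01.
rewrite ler_pdivrMr // in h2.
have n2 : n.+1%:R <= 2 * n%:R :> R by rewrite -natrM ler_nat; lia.
rewrite mulrAC ler_pdivlMr ?ltr0n // /c.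
rewrite exprS in h2.
apply: (@le_trans _ _ (n%:R ^+ k * (2 * n%:R))).
  by rewrite ler_wpM2l // exprn_ge0 // ltW.
by rewrite mulrCA -mulrA ler_pM2l // mulrC [leRHS]mulrC.
Unshelve. all: end_near. Qed.

(** The values Gamma(k/2 + 1). *)
Fixpoint half_gamma (R : realType) (k : nat) : R :=
  match k with
  | 0 => 1
  | 1 => Num.sqrt pi / 2
  | k'.+2 => k'.+2%:R / 2 * half_gamma R k'
  end.

Lemma cvg_gamma_partial (R : realType) k :
  gamma_partial k (n%:R : R) @[n --> \oo] --> half_gamma R k.
Proof.
have ev (u v : nat -> R) (l : R) : (forall n, (0 < n)%N -> u n = v n) ->
    v n @[n --> \oo] --> l -> u n @[n --> \oo] --> l.
  move=> uv; apply: cvg_trans; apply: near_eq_cvg.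
  by near=> n; rewrite uv //; near: n; exact: nbhs_infty_ge.
have n0 n : (0 < n)%N -> 0 < n%:R :> R by rewrite ltr0n.
elim/nat_ind2: k => [||k IH].
- apply: (ev _ (fun n => 1 - expR (- n%:R))).
    by move=> n /n0/gamma_partial0.
  rewrite -[half_gamma R 0]subr0; apply: cvgB; first exact: cvg_cst.
  have := @cvg_gamma_integrand R 0; apply: cvg_trans.
  by apply: near_eq_cvg; near=> n; rewrite /gamma_integrand expr0 mul1r.
- pose I := @gauss_integral_proof.integral0_gauss R.
  apply: (ev _ (fun n => I (Num.sqrt n%:R) - gamma_integrand 1 n%:R)).
    by move=> n /n0/gamma_partial1.
  rewrite -[half_gamma R 1]subr0; apply: cvgB; last exact: cvg_gamma_integrand.
  have sy : Num.sqrt (n%:R : R) @[n --> \oo] --> +oo.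
    apply/cvgryPge => A; near=> n.
    have An : A ^+ 2 <= n%:R by near: n; exact: nbhs_infty_ger.
    by rewrite (le_trans (ler_norm A)) // -sqrtr_sqr ler_wsqrtr.
  apply: (cvg_comp _ I sy).
  have := cvg_comp _ _ (@gauss_integral_proof.cvg_integral0_gauss_sqr R)
    (@sqrt_continuous R (pi / 4)).
  have -> : Num.sqrt (pi / 4 : R) = half_gamma R 1.
    rewrite sqrtrM ?pi_ge0 // sqrtrV // (_ : 4 = 2 ^+ 2) ?sqrtr_sqr ?ger0_norm //.
    by rewrite expr2 -natrM.
  apply: cvg_trans; apply: near_eq_cvg; near=> x.
  by rewrite /= sqrtr_sqr ger0_norm // gauss_integral_proof.integral0_gauss_ge0.
- apply: (ev _ (fun n => k.+2%:R / 2 * gamma_partial k n%:R - gamma_integrand k.+2 n%:R)).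
    by move=> n /n0/gamma_partialSS.
  rewrite -[half_gamma R k.+2]subr0; apply: cvgB; last exact: cvg_gamma_integrand.
  by apply: cvgMr; exact: IH.
Unshelve. all: end_near. Qed.

Lemma Gamma_half (R : realType) k : Gamma (k%:R / 2 + 1 : R) = half_gamma R k.
Proof.
transitivity (\int[lebesgue_measure]_(t in `]0%R, +oo[) gamma_integrand k (t : R)).
  apply: eq_Rintegral; move=> t; rewrite inE /= in_itv/= andbT => t0; rewrite addrK /gamma_integrand.
  by rewrite [_ / 2]mulrC powRrM powR12_sqrt ?ltW // powR_mulrn ?sqrtr_ge0.
rewrite /Rintegral integral_itv_obnd_cbnd; last first.
  apply/measurable_realfun.measurable_EFinP/measurable_funTS.
  apply: measurable_realfun.continuous_measurable_fun.
  exact: continuous_gamma_integrand.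
have g0 (t : R) : 0 <= gamma_integrand k t.
  by rewrite mulr_ge0 ?exprn_ge0 ?expR_ge0 ?sqrtr_ge0.
have := @ge0_cvgn_integral R lebesgue_measure _ g0
  (measurable_realfun.continuous_measurable_fun (@continuous_gamma_integrand R k)).
have -> : (fun n : nat => \int[lebesgue_measure]_(x in `[0%R, n%:R]) (gamma_integrand k x)%:E)%E
   = (fun n => (gamma_partial k (n%:R : R))%:E).
  apply/funext => n; rewrite /gamma_partial /Rintegral fineK //.
  exact: integrable_fin_num (integrable_gamma_integrand _ _).
move=> /cvg_lim => <- //.
have h : (gamma_partial k (n%:R : R))%:E @[n --> \oo] --> (half_gamma R k)%:E.
  by apply: cvg_EFin; [exact: nearW | exact: cvg_gamma_partial].
by rewrite (cvg_lim _ h).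
Qed.

(** Both sides are multiplied by pi / (2(k+2)) when k increases by two. *)
Lemma ball_volumeE (R : realType) k :
  ball_volume R k / 2 ^+ k = orthant_volume R k.
Proof.
rewrite /ball_volume Gamma_half.
have p0 : 0 < pi :> R := pi_gt0 R.
elim/nat_ind2: k => [||k IH].
- by rewrite mul0r powRr0 /= expr0 invr1 !mulr1.
- rewrite mul1r powR12_sqrt ?ltW // expr1 /= mulr1.
  by field; rewrite gt_eqF // sqrtr_gt0.
- rewrite orthant_volumeSS -IH.
  have -> : k.+2%:R / 2 = k%:R / 2 + 1 :> R.
    by rewrite -addn2 natrD mulrDl divff.
  rewrite powRD; last by rewrite gt_eqF ?implybT.
  rewrite powRr1 ?ltW // 2!exprS /=.
  have g0 : half_gamma R k != 0.
    elim/nat_ind2: k {IH} => [||k IH]; rewrite /= ?oner_eq0 //.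
      by rewrite mulf_neq0 // gt_eqF // sqrtr_gt0.
    by rewrite !mulf_neq0 // pnatr_eq0.
  have k2 : k.+2%:R != 0 :> R by rewrite pnatr_eq0.
  have p2 : 2 ^+ k != 0 :> R by rewrite expf_neq0.
  move: (k.+2%:R : R) (half_gamma R k) (2 ^+ k) g0 k2 p2 => a b c b0 a0 c0.
  by field; rewrite a0 b0 c0.
Qed.

(** * Expansion of f over systems of prime choices *)

(** Expanding the product gives a signed sum over all T; the term T = set0 is
    the 1 on the right-hand side. *)
Lemma inclusion_exclusion (A : comNzRingType) (I : finType) (y : I -> A) :
  \sum_(T : {set I}) (if T == finset.set0 then 0 else (-1) ^+ #|T|.+1 * \prod_(i in T) y i)
  = 1 - \prod_i (1 - y i).
Proof.
have -> : \prod_i (1 - y i) = \sum_(T : {set I}) (-1) ^+ #|T| * \prod_(i in T) y i.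
  rewrite (eq_bigr (fun i => - y i + 1)); last by move=> i _; rewrite addrC.
  rewrite bigA_distr; apply: eq_bigr => T _; rewrite -big_mkcond /=.
  by rewrite prodrN.
rewrite (bigD1 (finset.set0 : {set I})) //= eqxx add0r [in RHS](bigD1 (finset.set0 : {set I})) //=.
rewrite cards0 expr0 mul1r big_set0 opprD addrA subrr add0r -sumrN.
by apply: eq_bigr => T /negPf ->; rewrite exprS mulN1r mulNr.
Qed.

Lemma sum_option (V : nmodType) (T : finType) (F : option T -> V) :
  \sum_j F j = F None + \sum_t F (Some t).
Proof.
rewrite (bigD1 None) //=; congr (_ + _).
rewrite (reindex_omap Some id) /=; last by case.
by apply: eq_bigl => t; rewrite eqxx.
Qed.

(** None chooses nothing at a prime; Some (a, T) chooses the prime power of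
    exponent a + 1 and the set T of coordinates it has to divide.  The choices
    with T empty get coefficient 0. *)
Definition prime_choice (k V : nat) : finType := option ('I_V * {set 'I_k}).

Definition choice_exponent k V (j : prime_choice k V) (i : 'I_k) : nat :=
  if j is Some (a, T) then (if i \in T then a.+1 else 0%N) else 0%N.

Definition choice_coeff (A : comNzRingType) k V (f : nat -> A) (p : nat)
    (j : prime_choice k V) : A :=
  if j is Some (a, T) then
    if T == finset.set0 then 0 else (-1) ^+ #|T|.+1 * (f (p ^ a.+1)%N - f (p ^ a)%N)
  else 1.

(** The sum over T factors through inclusion-exclusion.  Taking for y the
    indicator of a + 1 <= nu_i gives the pointwise expansion of f, and taking
    p^-(a+1) gives the Euler factors. *)
Lemma sum_choice (A : comNzRingType) k V (f : nat -> A) p (y : nat -> 'I_k -> A) :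
  \sum_(j : prime_choice k V) choice_coeff f p j *
     (if j is Some (a, T) then \prod_(i in T) y a i else 1)
  = 1 + \sum_(a < V) (f (p ^ a.+1)%N - f (p ^ a)%N) * (1 - \prod_i (1 - y a i)).
Proof.
rewrite sum_option /= mulr1; congr (1 + _).
transitivity (\sum_(a < V) \sum_(T : {set 'I_k})
    choice_coeff f p (Some (a, T) : prime_choice k V) * \prod_(i in T) y a i).
  by rewrite pair_bigA; apply: eq_bigr => -[].
apply: eq_bigr => a _; rewrite -inclusion_exclusion mulr_sumr.
by apply: eq_bigr => T _ /=; case: ifP => _; rewrite ?mul0r ?mulr0 // mulrAC mulrC.
Qed.

Lemma telescope_max (A : comNzRingType) k V (f : nat -> A) p (nu : 'I_k -> nat) :
  f 1%N = 1 -> (forall i, (nu i <= V)%N) ->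
  1 + \sum_(a < V) (f (p ^ a.+1)%N - f (p ^ a)%N) * (a < \max_i nu i)%N%:R
  = f (p ^ \max_i nu i)%N.
Proof.
move=> f1 nuV; set m := \max_i nu i.
have mV : (m <= V)%N by apply/bigmax_leqP => i _; exact: nuV.
rewrite -(big_mkord xpredT (fun a => (f (p ^ a.+1)%N - f (p ^ a)%N) * (a < m)%N%:R)).
rewrite (big_cat_nat (n := m)) //= [X in _ + (_ + X)]big_nat_cond.
rewrite [X in _ + (_ + X)]big1 ?addr0; last first.
  by move=> a /andP[/andP[ma _] _]; rewrite ltnNge ma mulr0.
rewrite big_nat_cond (eq_bigr (fun a => f (p ^ a.+1)%N - f (p ^ a)%N)); last first.
  by move=> a /andP[/andP[_ ->] _]; rewrite mulr1.
rewrite -big_nat_cond (@telescope_sumr _ _ _ (fun a => f (p ^ a)%N)) //.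
by rewrite expn0 f1 addrC subrK.
Qed.

Lemma local_expansion (A : comNzRingType) k V (f : nat -> A) p (nu : 'I_k -> nat) :
  f 1%N = 1 -> (forall i, (nu i <= V)%N) ->
  \sum_(j : prime_choice k V) choice_coeff f p j *
     [forall i, (choice_exponent j i <= nu i)%N]%:R
  = f (p ^ \max_i nu i)%N.
Proof.
move=> f1 nuV; rewrite -(telescope_max p f1 nuV).
transitivity (\sum_(j : prime_choice k V) choice_coeff f p j *
     (if j is Some (a, T) then \prod_(i in T) (a < nu i)%N%:R else 1)).
  apply: eq_bigr => -[[a T]|] _ /=; congr (_ * _); last first.
    by rewrite (introT forallP _).
  case: (boolP [forall i, _]) => [/forallP h|]; last rewrite negb_forall => /existsP [] i.
    by rewrite big1 // => i iT; have := h i; rewrite iT => ->.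
  by case: ifP => // iT /negPf h; rewrite (bigD1 i) //= h mul0r.
rewrite (sum_choice V f p (fun a i => (a < nu i)%N%:R)).
congr (1 + _); apply: eq_bigr => a _; congr (_ * _).
case: ltnP => [|h]; last first.
  rewrite big1 ?subrr // => i _; rewrite ltnNge (leq_trans _ h) ?subr0 //.
  exact: (leq_bigmax i).
have [|k0] := posnP k; first by move=> k0; rewrite big1 // => -[i ik]; exfalso; rewrite k0 in ik.
have : (0 < #|'I_k|)%N by rewrite card_ord.
move=> /(bigop.eq_bigmax nu)[i0 ->] h.
by rewrite (bigD1 i0) //= h subrr mul0r subr0.
Qed.

Lemma logn_lcm_tuple k (n : {ffun 'I_k -> nat}) p :
  (forall i, (0 < n i)%N) -> 
  (0 < lcm_tuple n)%N /\ logn p (lcm_tuple n) = \max_i logn p (n i).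
Proof.
move=> n0; rewrite /lcm_tuple.
apply: (big_rec2 (fun a b => (0 < a)%N /\ logn p a = b)); first by rewrite logn1.
by move=> i a b _ [a0 <-]; rewrite lcmn_gt0 n0 a0 logn_lcm.
Qed.

Lemma coprime_prod_primes (e : nat -> nat) N c : prime N ->
  coprime (\prod_(0 <= p < N | prime p) p ^ e p) (N ^ c).
Proof.
move=> pN; rewrite big_nat_cond; apply: (big_ind (fun m => coprime m (N ^ c))).
- exact: coprime1n.
- by move=> a b ha hb; rewrite coprimeMl ha hb.
- move=> p /andP[/andP[_ lpN] pp]; apply: coprimeXl; apply: coprimeXr.
  by rewrite prime_coprime // dvdn_prime2 // ltn_eqF.
Qed.

(** The primes below N are peeled off one at a time. *)
Lemma multiplicative_prod_primes (R : realType) (f : nat -> R[i]) (e : nat -> nat) N :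
  multiplicative_fun f ->
  f (\prod_(p < N | prime p) p ^ e p)%N = \prod_(p < N | prime p) f (p ^ e p)%N.
Proof.
move=> [f1 fM].
rewrite -(big_mkord prime (fun p => (p ^ e p)%N)) -(big_mkord prime (fun p => f (p ^ e p)%N)).
elim: N => [|N IH]; first by rewrite !big_geq.
rewrite [in LHS]big_mkcond [RHS]big_mkcond !big_nat_recr //=.
rewrite -!big_mkcond /= -IH; case: ifP => pN; last by rewrite muln1 mulr1.
rewrite fM //.
- by apply: prodn_cond_gt0 => p pp; rewrite expn_gt0 prime_gt0.
- by rewrite expn_gt0 prime_gt0.
- exact: coprime_prod_primes.
Qed.

Lemma prod_primes_logn N m : (0 < m)%N ->
  (forall p, prime p -> (N <= p)%N -> logn p m = 0%N) ->
  (\prod_(p < N | prime p) p ^ logn p m)%N = m.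
Proof.
move=> m0 hN; rewrite -(big_mkord prime (fun p => (p ^ logn p m)%N)).
rewrite -[RHS](partnT m0) (@widen_partn (m + N) _ m) ?leq_addr //.
rewrite [RHS](big_cat_nat (n := N)) //=; last by lia.
rewrite [X in (_ * X)%N]big_nat_cond [X in (_ * X)%N]big1 ?muln1; last first.
  move=> p /andP[/andP[Np _] _]; have [pp|npp] := boolP (prime p).
    by rewrite hN.
  by rewrite lognE (negPf npp).
rewrite big_mkcond; apply: eq_bigr => p _; case: ifPn => // npp.
by rewrite lognE (negPf npp).
Qed.

Lemma multiplicative_lcm_tuple (R : realType) k N (f : nat -> R[i])
    (n : {ffun 'I_k -> nat}) :
  multiplicative_fun f -> (forall i, (0 < n i < N)%N) ->
  f (lcm_tuple n) = \prod_(p < N | prime p) f (p ^ \max_i logn p (n i))%N.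
Proof.
move=> fM nN; have n0 i : (0 < n i)%N by case/andP: (nN i).
have L p := logn_lcm_tuple p n0.
rewrite -{1}(@prod_primes_logn N (lcm_tuple n)).
- rewrite (multiplicative_prod_primes (fun p => logn p (lcm_tuple n)) N fM).
  apply: eq_bigr => p _.
  by rewrite (L p).2.
- by case: (L 0%N).
- move=> p pp Np; rewrite (L p).2; apply/eqP; rewrite -leqn0.
  apply/bigmax_leqP => i _; rewrite leqNgt logn_gt0 mem_primes pp n0 /=.
  apply/negP => /(dvdn_leq (n0 i)) pn; case/andP: (nN i) => _; lia.
Qed.

Lemma dvdn_prod_primes (e : nat -> nat) N m : (0 < m)%N ->
  (\prod_(p < N | prime p) p ^ e p %| m)%N
  = [forall p : 'I_N, prime p ==> (e p <= logn p m)%N].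
Proof.
move=> m0; rewrite -(big_mkord prime (fun p => (p ^ e p)%N)).
elim: N => [|N IH].
  by rewrite big_geq // dvd1n; apply/esym/forallP => -[].
rewrite big_mkcond big_nat_recr //= -big_mkcond /=.
apply/idP/forallP => [h p|h].
- apply/implyP => pp; case: (ltngtP p N) => [pN|Np|pN]; last first.
  + move: h; rewrite pN in pp *; rewrite pp -pfactor_dvdn // => h.
    exact: dvdn_trans (dvdn_mull _ (dvdnn _)) h.
  + by have := ltn_ord p; rewrite ltnS leqNgt Np.
  + have : (\prod_(0 <= i < N | prime i) i ^ e i %| m)%N.
      exact: dvdn_trans (dvdn_mulr _ (dvdnn _)) h.
    by rewrite IH => /forallP/(_ (Ordinal pN)); rewrite pp.
- have hN : (\prod_(0 <= i < N | prime i) i ^ e i %| m)%N.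
    by rewrite IH; apply/forallP => p; have := h (widen_ord (leqnSn N) p).
  case: ifPn => [pN|_]; last by rewrite muln1.
  rewrite Gauss_dvd ?coprime_prod_primes // hN pfactor_dvdn //.
  by have := h ord_max; rewrite /= pN.
Qed.

(** At a non-prime the only admissible choice is None; indexing by all p < N
    keeps the systems in a plain function type. *)
Definition prime_coeff (A : comNzRingType) k V (f : nat -> A) (p : nat)
    (j : prime_choice k V) : A :=
  if prime p then choice_coeff f p j else (j == None)%:R.

Definition system_coeff (A : comNzRingType) k V N (f : nat -> A)
    (phi : {ffun 'I_N -> prime_choice k V}) : A :=
  \prod_(p < N) prime_coeff f p (phi p).

Definition system_divisor k V N (phi : {ffun 'I_N -> prime_choice k V})
    (i : 'I_k) : nat :=
  \prod_(p < N | prime p) p ^ choice_exponent (phi p) i.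

Lemma system_divisor_gt0 k V N (phi : {ffun 'I_N -> prime_choice k V}) i :
  (0 < system_divisor phi i)%N.
Proof. by apply: prodn_cond_gt0 => p pp; rewrite expn_gt0 prime_gt0. Qed.

Lemma system_divisor_dvdn k V N (phi : {ffun 'I_N -> prime_choice k V})
    (n : 'I_k -> nat) : (forall i, (0 < n i)%N) ->
  [forall i, (system_divisor phi i %| n i)%N] =
  [forall p : 'I_N, prime p ==>
     [forall i, (choice_exponent (phi p) i <= logn p (n i))%N]].
Proof.
move=> n0.
have E i : (system_divisor phi i %| n i)%N =
    [forall p : 'I_N, prime p ==> (choice_exponent (phi p) i <= logn p (n i))%N].
  (* The induction on N needs exponents defined on all naturals. *)
  pose e p := if insub p is Some q then choice_exponent (phi q) i else 0%N.
  have eE (p : 'I_N) : e p = choice_exponent (phi p) i by rewrite /e valK.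
  have -> : system_divisor phi i = (\prod_(p < N | prime p) p ^ e p)%N.
    by apply: eq_bigr => p _; rewrite eE.
  rewrite (dvdn_prod_primes e N (n0 i)).
  by apply: eq_forallb => p; rewrite eE.
apply/forallP/forallP => [h p|h i].
- by apply/implyP => pp; apply/forallP => i; have := h i; rewrite E => /forallP/(_ p)/implyP; exact.
- rewrite E; apply/forallP => p; apply/implyP => pp.
  by have /implyP/(_ pp)/forallP := h p; exact.
Qed.

(** The product over p of the local expansions, distributed over the choices.
    The bound N <= V makes V larger than every exponent that occurs. *)
Lemma lcm_expansion (R : realType) k V N (f : nat -> R[i]) (n : {ffun 'I_k -> nat}) :
  multiplicative_fun f -> (forall i, (0 < n i < N)%N) -> (N <= V)%N ->
  f (lcm_tuple n) =
  \sum_(phi : {ffun 'I_N -> prime_choice k V}) system_coeff f phi *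
     [forall i, (system_divisor phi i %| n i)%N]%:R.
Proof.
move=> fM nN NV; rewrite (multiplicative_lcm_tuple fM nN) big_mkcond /=.
have f1 : f 1%N = 1 by case: fM.
have n0 i : (0 < n i)%N by case/andP: (nN i).
transitivity (\prod_(p < N) \sum_(j : prime_choice k V) prime_coeff f p j *
   (prime p ==> [forall i, (choice_exponent j i <= logn p (n i))%N])%:R).
  apply: eq_bigr => p _; rewrite /prime_coeff; case: ifP => pp.
    rewrite -(@local_expansion _ k V) // => i.
    apply: leq_trans NV; apply: leq_trans (ltnW (proj2 (andP (nN i)))).
    by rewrite ltnW // ltn_logl.
  rewrite sum_option eqxx mulr1 big1 ?addr0 // => t _.
  by rewrite mul0r.
rewrite bigA_distr_bigA /=; apply: eq_bigr => phi _.
rewrite big_split /=; congr (_ * _); rewrite system_divisor_dvdn //.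
case: (boolP [forall p, _]) => [/forallP h|].
  by rewrite big1 // => p _; rewrite h.
rewrite negb_forall => /existsP [] p /negPf h.
by rewrite (bigD1 p) //= h mul0r.
Qed.

(** * The sum over the ball as a sum over systems *)

Definition ord_tuple k N (g : {ffun 'I_k -> 'I_N}) : {ffun 'I_k -> nat} :=
  [ffun i => nat_of_ord (g i)].

Lemma lcm_sum_box (R : realType) k N (f : nat -> R[i]) (x : R) : x < N%:R ^+ 2 ->
  lcm_sum k f x =
  \sum_(g : {ffun 'I_k -> 'I_N} | [forall i, (0 < g i)%N]
      && (\sum_i (g i)%:R ^+ 2 <= x)) f (lcm_tuple (ord_tuple g)).
Proof.
move=> xN; rewrite -big_filter -(big_map (@ord_tuple k N) xpredT (fun n => f (lcm_tuple n))).
rewrite fsbig_seq; last first.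
  rewrite map_inj_uniq ?filter_uniq ?index_enum_uniq // => g g' /ffunP h.
  by apply/ffunP => i; apply/val_inj; have := h i; rewrite !ffunE.
apply: eq_fsbigl; apply/seteqP; split=> n /=.
- move=> [n0 nx].
  have nN i : (n i < N)%N.
    have : (n i)%:R ^+ 2 < N%:R ^+ 2 :> R.
      apply: le_lt_trans xN; apply: le_trans nx; rewrite (bigD1 i) //= lerDl.
      by apply: sumr_ge0 => j _; rewrite sqr_ge0.
    by rewrite ltr_sqr ?nnegrE // ltr_nat.
  apply/mapP; exists [ffun i => Ordinal (nN i)].
    rewrite mem_filter mem_index_enum andbT; apply/andP; split.
      by apply/forallP => i; rewrite ffunE; exact: n0.
    by under eq_bigr do rewrite ffunE.
  by apply/ffunP => i; rewrite !ffunE.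
- case/mapP => g; rewrite mem_filter => /andP[/andP[/forallP g0 gx] _] ->; split.
    by move=> i; rewrite ffunE; exact: g0.
  by under eq_bigr do rewrite ffunE.
Qed.

Lemma lcm_sum_systems (R : realType) k V N (f : nat -> R[i]) (x : R) :
  multiplicative_fun f -> x < N%:R ^+ 2 -> (N <= V)%N ->
  lcm_sum k f x =
  \sum_(phi : {ffun 'I_N -> prime_choice k V})
     system_coeff f phi * (lattice_count (system_divisor phi) N x)%:C.
Proof.
move=> fM xN NV; rewrite (lcm_sum_box k f xN).
transitivity (\sum_(g : {ffun 'I_k -> 'I_N} | [forall i, (0 < g i)%N]
      && (\sum_i (g i)%:R ^+ 2 <= x))
   \sum_(phi : {ffun 'I_N -> prime_choice k V}) system_coeff f phi *
     [forall i, (system_divisor phi i %| g i)%N]%:R).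
  apply: eq_bigr => g /andP[/forallP g0 _].
  rewrite (@lcm_expansion _ _ V N) //; last first.
    by move=> i; rewrite ffunE g0 ltn_ord.
  apply: eq_bigr => phi _; congr (_ * (nat_of_bool _)%:R).
  by apply: eq_forallb => i; rewrite ffunE.
rewrite exchange_big /=; apply: eq_bigr => phi _.
rewrite -mulr_sumr; congr (_ * _).
rewrite /lattice_count rmorph_sum /= big_mkcond /=; apply: eq_bigr => g _.
rewrite rmorph_nat -[RHS]/((_ && _)%:R).
have -> : [forall i, (0 < g i)%N && (system_divisor phi i %| g i)%N] =
    [forall i, (0 < g i)%N] && [forall i, (system_divisor phi i %| g i)%N].
  apply/forallP/andP => [h|[/forallP h1 /forallP h2] i]; last by rewrite h1 h2.
  by split; apply/forallP => i; case/andP: (h i).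
by rewrite andbAC; case: ifP => // ->.
Qed.

(** * Uniform bounds for the systems *)

(** The size of f(p^(a+1)) - f(p^a): only the first jump is small. *)
Definition jump_bound (R : realType) (C : R) (p a : nat) : R :=
  if a is 0 then C * p%:R `^ (- 2^-1) else C.

Lemma jump_bound_ge0 (R : realType) (C : R) p a : 0 <= C -> 0 <= jump_bound C p a.
Proof. by move=> C0; case: a => //=; rewrite mulr_ge0 // powR_ge0. Qed.

(** The condition at a prime, where f(1) = 1, bounds the jump with a = 0 by
    C p^(-1/2), and every other jump is a difference of two bounded values. *)
Lemma class_A0_jump (R : realType) (f : nat -> R[i]) : class_A0 f ->
  exists C : R, 0 <= C /\
    (forall p a, prime p ->
       `|f (p ^ a.+1)%N - f (p ^ a)%N| <= (jump_bound C p a)%:C) /\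
    (forall p a, prime p -> `|f (p ^ a)%N| <= C%:C).
Proof.
move=> [[f1 _] [C1 [C2 [h1 h2]]]]; exists (`|C1| + 2 * `|C2| + 1).
have a1 : 0 <= `|C1| by [].
have a2 : 0 <= `|C2| by [].
have ple p : prime p -> p%:R `^ (- 2^-1) <= 1 :> R.
  by move=> pp; rewrite -[leRHS](powRr0 (p%:R : R)) ler_powR ?ler1n ?prime_gt0 // oppr_le0.
have g1 p : prime p -> `|f p - 1| <= (`|C1| * p%:R `^ (- 2^-1))%:C.
  move=> pp; apply: le_trans (h1 p pp) _; rewrite lecR.
  by rewrite ler_wpM2r ?powR_ge0 // ler_norm.
have g1' p : prime p -> `|f p| <= (`|C1| + 1)%:C.
  move=> pp; rewrite -[f p](subrK 1) (le_trans (ler_normD _ _)) // normr1.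
  rewrite rmorphD rmorph1 lerD2r (le_trans (g1 p pp)) // lecR.
  by rewrite ler_piMr // ple.
have g2 p a : prime p -> `|f (p ^ a.+2)%N| <= `|C2|%:C.
  by move=> pp; apply: le_trans (h2 _ _ pp _) _; rewrite ?lecR ?ler_norm.
split; first by rewrite !addr_ge0 // mulr_ge0.
split=> p a pp.
- case: a => [|[|a]] /=.
  + rewrite expn0 expn1 f1 (le_trans (g1 p pp)) // lecR ler_wpM2r ?powR_ge0 //.
    by lra.
  + rewrite (le_trans (ler_normB _ _)) // expn1.
    apply: le_trans (lerD (g2 p 0%N pp) (g1' p pp)) _.
    by rewrite -rmorphD lecR; lra.
  + rewrite (le_trans (ler_normB _ _)) //.
    apply: le_trans (lerD (g2 p a.+1 pp) (g2 p a pp)) _.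
    by rewrite -rmorphD lecR; lra.
- case: a => [|[|a]].
  + by rewrite expn0 f1 normr1 -[1](rmorph1 (real_complex R)) lecR; lra.
  + by rewrite expn1 (le_trans (g1' p pp)) // lecR; lra.
  + by rewrite (le_trans (g2 p a pp)) // lecR; lra.
Qed.

Definition choice_height k V (j : prime_choice k V) : nat :=
  if j is Some (a, T) then a.+1 else 0%N.

(** The majorant of the coefficient of a choice. *)
Definition prime_weight (R : realType) k V (C : R) (p : nat)
    (j : prime_choice k V) : R :=
  if prime p then
    if j is Some (a, T) then
      if T == finset.set0 then 0 else jump_bound C p a
    else 1
  else (j == None)%:R.

Lemma prime_weight_ge0 (R : realType) k V (C : R) p (j : prime_choice k V) :
  0 <= C -> 0 <= prime_weight C p j.
Proof.
move=> C0; rewrite /prime_weight; case: ifP => // _.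
by case: j => // -[a T]; case: ifP => // _; exact: jump_bound_ge0.
Qed.

Lemma prime_coeff_bound (R : realType) k V (C : R) (f : nat -> R[i]) p
    (j : prime_choice k V) :
  (forall p a, prime p ->
     `|f (p ^ a.+1)%N - f (p ^ a)%N| <= (jump_bound C p a)%:C) ->
  `|prime_coeff f p j| <= (prime_weight C p j)%:C.
Proof.
move=> hf; rewrite /prime_coeff /prime_weight; case: ifP => pp; last first.
  by rewrite rmorph_nat normr_nat.
case: j => [[a T]|] /=; last by rewrite normr1.
case: ifP => _; first by rewrite normr0.
by rewrite normrMsign hf.
Qed.

Lemma powR_prod_primes (R : realType) N (e : 'I_N -> nat) (s : R) :
  (\prod_(p < N | prime p) p ^ e p)%N%:R `^ s
  = \prod_(p < N | prime p) (p%:R `^ s) ^+ e p :> R.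
Proof.
apply: (big_ind2 (fun (m : nat) (z : R) => m%:R `^ s = z)).
- by rewrite powR1.
- by move=> m u n v <- <-; rewrite natrM powRM.
- move=> p pp; rewrite natrX -(powR_mulrn (e p) (ler0n R p)).
  by rewrite powRAC -(powR_mulrn (e p) (powR_ge0 p%:R s)).
Qed.

Definition system_height k V N (phi : {ffun 'I_N -> prime_choice k V}) : nat :=
  \prod_(p < N | prime p) p ^ choice_height (phi p).

Lemma system_divisor_le k V N (phi : {ffun 'I_N -> prime_choice k V}) i :
  (system_divisor phi i <= system_height phi)%N.
Proof.
apply: leq_prod => p pp; rewrite leq_exp2l ?prime_gt1 //.
by case: (phi p) => //= -[a T]; case: ifP.
Qed.

Lemma system_height_gt0 k V N (phi : {ffun 'I_N -> prime_choice k V}) :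
  (0 < system_height phi)%N.
Proof. by apply: prodn_cond_gt0 => p pp; rewrite expn_gt0 prime_gt0. Qed.

(** A nonzero weight forces every chosen T to be nonempty, so that each chosen
    prime power divides at least one of the d_i. *)
Lemma system_height_le (R : realType) k V N (C : R)
    (phi : {ffun 'I_N -> prime_choice k V}) :
  \prod_(p < N) prime_weight C p (phi p) != 0 ->
  (system_height phi <= \prod_i system_divisor phi i)%N.
Proof.
move=> /prodf_neq0 h; rewrite /system_divisor exchange_big /=.
apply: leq_prod => p pp; rewrite -expn_sum leq_exp2l ?prime_gt1 //.
have := h p isT; rewrite /prime_weight pp.
case: (phi p) => //= -[a T]; case: ifPn => [_|/set0Pn[i iT] _]; first by rewrite eqxx.
by rewrite (bigD1 i) //= iT leq_addr.
Qed.

Lemma min1_le_powR (R : realType) (t s : R) : 0 < t -> 0 <= s <= 1 ->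
  Num.min 1 t <= t `^ s.
Proof.
move=> t0 /andP[s0 s1]; case: (leP t 1) => [t1|/ltW t1].
  rewrite -[leLHS](powRr1 (ltW t0)).
  by apply: ger_powR => //; rewrite t0.
by rewrite -[leLHS](powRr0 t) ler_powR.
Qed.

(** From d_i <= m <= prod d_i and min(1, t) <= t^s follows
    min(1, d_i/y) / prod d_i <= y^(-s) m^(s-1), and the right-hand side is
    multiplicative in the choices. *)
Lemma system_weight_bound (R : realType) k V N (C s y : R)
    (phi : {ffun 'I_N -> prime_choice k V}) : 0 <= C -> 0 <= s <= 1 -> 0 < y ->
  (\prod_(p < N) prime_weight C p (phi p)) / (\prod_i (system_divisor phi i)%:R)
     * \sum_i Num.min 1 ((system_divisor phi i)%:R / y)
  <= k%:R * y `^ (- s) *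
     \prod_(p < N) (prime_weight C p (phi p) *
                    (if prime p then (p%:R `^ (s - 1)) ^+ choice_height (phi p) else 1)).
Proof.
move=> C0 /andP[s0 s1] y0; rewrite big_split /= -big_mkcond /=.
have := powR_prod_primes (fun p => choice_height (phi p)) (s - 1).
rewrite -/(system_height phi) => <-.
set W := \prod_(p < N) _; set D := \prod_(i < k) _; set m := (system_height phi)%:R.
have m0 : 0 < m by rewrite ltr0n system_height_gt0.
have D0 : 0 < D by apply: prodr_gt0 => i _; rewrite ltr0n system_divisor_gt0.
have W0 : 0 <= W by apply: prodr_ge0 => p _; exact: prime_weight_ge0.
have [WE|Wn0] := eqVneq W 0; first by rewrite WE !mul0r mulr0.
have mD : m <= D.
  by rewrite /m /D -natr_prod ler_nat (system_height_le Wn0).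
have S1 : \sum_(i < k) Num.min 1 ((system_divisor phi i)%:R / y) <= k%:R * (m / y) `^ s.
  apply: (@le_trans _ _ (\sum_(i < k) (m / y) `^ s)); last first.
    by rewrite sumr_const card_ord mulr_natl.
  apply: ler_sum => i _; have s01 : 0 <= s <= 1 by rewrite s0.
  have d0 : 0 < (system_divisor phi i)%:R / y.
    by rewrite divr_gt0 // ltr0n system_divisor_gt0.
  apply: le_trans (min1_le_powR d0 s01) _.
  apply: ge0_ler_powR; rewrite ?nnegrE ?(ltW d0) //.
    by rewrite divr_ge0 // ltW.
  by rewrite ler_pM2r ?invr_gt0 // ler_nat system_divisor_le.
have S0 : 0 <= \sum_(i < k) Num.min 1 ((system_divisor phi i)%:R / y).
  by apply: sumr_ge0 => i _; rewrite le_min ler01 divr_ge0 // ltW.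
apply: (@le_trans _ _ (W / m * (k%:R * (m / y) `^ s))).
  apply: ler_pM => //; first by rewrite divr_ge0 // ltW.
  by rewrite ler_wpM2l // lef_pV2.
have mn0 : m != 0 by rewrite gt_eqF.
rewrite powRM ?invr_ge0 ?(ltW m0) ?(ltW y0) // -[y^-1]powR_inv1 ?(ltW y0) //.
rewrite -powRrM mulN1r powRB ?mn0 ?implybT // powRr1 ?(ltW m0) //.
rewrite le_eqVlt; apply/orP; left; apply/eqP; by field.
Qed.

Lemma prime_rpow_le (R : realType) (t : R) p : prime p -> 0 <= t ->
  p%:R `^ (- (2^-1 + t)) <= 3 / 4 :> R.
Proof.
move=> pp t0; have p2 : 2 <= p%:R :> R by rewrite ler_nat prime_gt1.
have p1 : 1 <= p%:R :> R by lra.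
apply: (@le_trans _ _ (p%:R `^ (- 2^-1))).
  by apply: ler_powR => //; rewrite lerN2; lra.
rewrite powRN powR12_sqrt ?ler0n //.
have s0 : 0 < Num.sqrt p%:R :> R by rewrite sqrtr_gt0; lra.
(* (4/3)^2 = 16/9 <= 2 <= p. *)
have s43 : 4 / 3 <= Num.sqrt p%:R :> R.
  rewrite -[leLHS]ger0_norm; last by lra.
  rewrite -sqrtr_sqr; apply: ler_wsqrtr; nra.
by rewrite -[leLHS]mul1r ler_pdivrMr //; lra.
Qed.

Lemma geometric_le (R : realType) (r : R) V : 0 <= r <= 3 / 4 ->
  \sum_(a < V) r ^+ a <= 4.
Proof.
move=> /andP[r0 r1]; have r10 : 0 < 1 - r by lra.
have : (1 - r) * \sum_(a < V) r ^+ a <= 1.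
  have -> : (1 - r) * \sum_(a < V) r ^+ a = 1 - r ^+ V by rewrite -opprB mulNr -subrX1 opprB.
  by rewrite gerBl exprn_ge0.
have : 0 <= \sum_(a < V) r ^+ a by apply: sumr_ge0 => a _; rewrite exprn_ge0.
by nra.
Qed.

(** With s = 1/2 - d and r = p^(s-1) = p^(-1/2-d), the first jump contributes
    p^(-1/2) r = p^(-1-d), and the others a geometric series of first term
    r^2 <= p^(-1-d) and ratio r <= 3/4.  The factor 2^k counts the sets T. *)
Lemma local_weight_le (R : realType) k V (C d : R) p : prime p -> 0 <= C -> 0 < d ->
  \sum_(j : prime_choice k V) prime_weight C p j *
     (p%:R `^ (2^-1 - d - 1)) ^+ choice_height j
  <= 1 + 2 ^+ k * (5 * C) * p%:R `^ (- (1 + d)).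
Proof.
move=> pp C0 d0; rewrite sum_option /= /prime_weight pp mulr1 lerD2l.
set r := p%:R `^ _; set q := p%:R `^ (- (1 + d)).
have p1 : 1 <= p%:R :> R by rewrite ler1n prime_gt0.
have p0 : p%:R != 0 :> R by rewrite pnatr_eq0 -lt0n prime_gt0.
have rE : r = p%:R `^ (- (2^-1 + d)) by congr (_ `^ _); lra.
have r34 : 0 <= r <= 3 / 4 by rewrite powR_ge0 rE prime_rpow_le // ltW.
have r0 : 0 <= r by case/andP: r34.
have rq : p%:R `^ (- 2^-1) * r = q.
  by rewrite rE -powRD ?p0 ?implybT //; congr (_ `^ _); lra.
have r2q : r ^+ 2 <= q.
  rewrite rE expr2 -powRD ?p0 ?implybT //; apply: ler_powR => //; lra.
have jump_sum : \sum_(a < V) jump_bound C p a * r ^+ a.+1 <= 5 * C * q.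
  have q0 : 0 <= q by exact: powR_ge0.
  case: V => [|V]; first by rewrite big_ord0 !mulr_ge0.
  rewrite big_ord_recl /= expr1 -mulrA rq.
  have -> : \sum_(i < V) jump_bound C p (bump 0 i) * r ^+ (bump 0 i).+1
     = C * r ^+ 2 * \sum_(i < V) r ^+ i.
    rewrite mulr_sumr; apply: eq_bigr => i _; rewrite /bump leq0n add1n /=.
    by rewrite -mulrA -exprD add2n.
  have := geometric_le V r34.
  set S := \sum_(i < V) _ => S4.
  have : C * r ^+ 2 * S <= C * r ^+ 2 * 4.
    by rewrite ler_wpM2l // mulr_ge0 // exprn_ge0.
  have : C * r ^+ 2 <= C * q by rewrite ler_wpM2l.
  lra.
apply: (@le_trans _ _ (\sum_(T : {set 'I_k}) \sum_(a < V) jump_bound C p a * r ^+ a.+1)).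
  rewrite exchange_big /= pair_bigA /=; apply: ler_sum => -[a T] _ /=.
  case: ifP => // _; rewrite mul0r mulr_ge0 ?exprn_ge0 //; exact: jump_bound_ge0.
have cE : #|{: {set 'I_k}}| = (2 ^ k)%N.
  by rewrite -cardsT -powersetT card_powerset cardsT card_ord.
rewrite sumr_const cE -[leLHS]mulr_natl natrX -[leRHS]mulrA.
by rewrite ler_wpM2l // exprn_ge0.
Qed.

(** Comparison with the telescoping differences of t^(-d) / d. *)
Lemma sum_npow_le (R : realType) (d : R) N : 0 < d ->
  \sum_(1 <= n < N) n%:R `^ (- (1 + d)) <= 1 + d^-1.
Proof.
move=> d0.
have step n : (0 < n)%N ->
    n.+1%:R `^ (- (1 + d)) <= d^-1 * (n%:R `^ (- d) - n.+1%:R `^ (- d)).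
  move=> n0; have n0' : 0 < n%:R :> R by rewrite ltr0n.
  have lt : n%:R < n.+1%:R :> R by rewrite ltr_nat.
  have df (x : R) : x \in `]n%:R, n.+1%:R[ ->
      is_derive x 1 ((@powR R)^~ (- d)) (- d * x `^ (- d - 1)).
    rewrite in_itv/= => /andP[nx _]; apply: is_derive1_powR; exact: lt_trans nx.
  have cf : {within `[n%:R, n.+1%:R : R], continuous ((@powR R)^~ (- d))}.
    apply: continuous_in_subspaceT => x; rewrite inE /= in_itv/= => /andP[nx _].
    have x0 : 0 < x by exact: lt_le_trans nx.
    have [dx _] := is_derive1_powR (- d) x0.
    by apply: differentiable_continuous; rewrite -derivable1_diffP.
  have [c] := MVT lt df cf.
  rewrite in_itv/= => /andP[nc cn]; rewrite -natr1 addrAC subrr add0r mulr1 natr1 => E.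
  have -> : n%:R `^ (- d) - n.+1%:R `^ (- d) = d * c `^ (- d - 1).
    by rewrite -opprB E mulNr opprK.
  rewrite mulrA mulVf ?gt_eqF // mul1r.
  have -> : - d - 1 = - (1 + d) by rewrite opprD addrC.
  have c0 : 0 < c by exact: lt_trans nc.
  rewrite !powRN lef_pV2 ?posrE ?powR_gt0 ?ltr0n //.
  by apply: ge0_ler_powR; rewrite ?nnegrE ?ltW // addr_gt0.
have B0 : 0 <= 1 + d^-1 by rewrite addr_ge0 // invr_ge0 ltW.
case: N => [|[|N]]; [by rewrite big_geq | by rewrite big_geq |].
rewrite big_ltn // powR1 lerD2l big_add1 /=.
apply: (@le_trans _ _ (\sum_(1 <= n < N.+1) d^-1 * (n%:R `^ (- d) - n.+1%:R `^ (- d)))).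
  by rewrite !big_nat; apply: ler_sum => n /andP[n1 _]; exact: step.
rewrite -mulr_sumr ler_piMr ?invr_ge0 ?(ltW d0) //.
have -> : \sum_(1 <= n < N.+1) (n%:R `^ (- d) - n.+1%:R `^ (- d))
    = 1 - N.+1%:R `^ (- d) :> R.
  have := @telescope_sumr R 1 N.+1 (fun n => n%:R `^ (- d)) isT.
  rewrite powR1 => T; apply: oppr_inj; rewrite opprB -T -sumrN.
  by apply: eq_bigr => n _; rewrite opprB.
by rewrite gerBl powR_ge0.
Qed.

Lemma euler_product_le (R : realType) k (C d : R) : 0 <= C -> 0 < d ->
  exists K : R, 0 <= K /\ forall V N,
  \prod_(p < N) \sum_(j : prime_choice k V) prime_weight C p j *
     (if prime p then (p%:R `^ (2^-1 - d - 1)) ^+ choice_height j else 1) <= K.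
Proof.
move=> C0 d0; pose B : R := 2 ^+ k * (5 * C).
have B0 : 0 <= B by rewrite !mulr_ge0 // exprn_ge0.
exists (expR (B * (1 + d^-1))); split; first exact: expR_ge0.
move=> V N.
apply: (@le_trans _ _ (\prod_(0 <= p < N | (0 < p)%N) expR (B * p%:R `^ (- (1 + d))))).
  rewrite big_mkord [leRHS]big_mkcond; apply: ler_prod => p _.
  have S0 : 0 <= \sum_(j : prime_choice k V) prime_weight C p j *
     (if prime p then (p%:R `^ (2^-1 - d - 1)) ^+ choice_height j else 1).
    apply: sumr_ge0 => j _; rewrite mulr_ge0 ?prime_weight_ge0 //.
    by case: ifP => // _; rewrite exprn_ge0 ?powR_ge0.
  rewrite S0 /=; case: (boolP (prime p)) => pp.
    rewrite prime_gt0 //; apply: le_trans (local_weight_le k V pp C0 d0) _.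
    by rewrite -/B expR_ge1Dx.
  rewrite (eq_bigr (fun j : prime_choice k V => (j == None)%:R)); last first.
    by move=> j _; rewrite /prime_weight (negPf pp) mulr1.
  rewrite sum_option big1 //= addr0; case: ifP => // _.
  by rewrite -[leLHS]expR0 ler_expR mulr_ge0 // powR_ge0.
case: N => [|N].
  by rewrite big_geq // -[leLHS]expR0 ler_expR mulr_ge0 // addr_ge0 // invr_ge0 ltW.
rewrite big_mkcond big_ltn //= mul1r.
rewrite (eq_big_nat _ _ (F2 := fun p => expR (B * p%:R `^ (- (1 + d))))); last first.
  by move=> p /andP[-> _].
rewrite -(big_morph _ (@expRD R) (@expR0 R)) ler_expR -mulr_sumr.
by rewrite ler_wpM2l // sum_npow_le.
Qed.

(** * Approximation by truncated Euler products *)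

(** The local density sum truncated to exponents at most V: p^(a+1) divides
    the least common multiple of k random integers with probability
    1 - (1 - p^-(a+1))^k. *)
Definition local_partial (R : realType) k V (f : nat -> R[i]) (p : nat) : R[i] :=
  1 + \sum_(a < V) (f (p ^ a.+1)%N - f (p ^ a)%N)
        * (1 - (1 - (p%:R^-1) ^+ a.+1) ^+ k).

Lemma sum_prime_coeff (R : realType) k V (f : nat -> R[i]) p : prime p ->
  \sum_(j : prime_choice k V) prime_coeff f p j *
     \prod_i (p%:R^-1) ^+ choice_exponent j i
  = local_partial k V f p.
Proof.
move=> pp; rewrite /prime_coeff pp /local_partial.
transitivity (1 + \sum_(a < V) (f (p ^ a.+1)%N - f (p ^ a)%N)
    * (1 - \prod_(i < k) (1 - (p%:R^-1) ^+ a.+1))); last first.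
  by congr (1 + _); apply: eq_bigr => a _; rewrite prodr_const card_ord.
rewrite -(sum_choice V f p (fun a (i : 'I_k) => (p%:R^-1) ^+ a.+1)).
apply: eq_bigr => -[[a T]|] _ /=; congr (_ * _).
  by rewrite [RHS]big_mkcond /=; apply: eq_bigr => i _; case: ifP.
by rewrite big1.
Qed.

Lemma sum_systems_prod (R : realType) k V N (f : nat -> R[i]) :
  \sum_(phi : {ffun 'I_N -> prime_choice k V})
     system_coeff f phi / \prod_i (system_divisor phi i)%:R
  = \prod_(p < N | prime p) local_partial k V f p.
Proof.
rewrite [RHS]big_mkcond /=.
transitivity (\prod_(p < N) \sum_(j : prime_choice k V) prime_coeff f p j *
   (if prime p then \prod_i (p%:R^-1) ^+ choice_exponent j i else 1)); last first.
  apply: eq_bigr => p _; case: ifP => pp; first exact: sum_prime_coeff.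
  rewrite /prime_coeff pp sum_option /= mulr1 big1 ?addr0 // => t _.
  by rewrite mul0r.
rewrite bigA_distr_bigA /=; apply: eq_bigr => phi _.
rewrite big_split /=; congr (_ * _).
rewrite -prodfV -big_mkcond exchange_big /=; apply: eq_bigr => i _.
rewrite natr_prod -prodfV; apply: eq_bigr => p _.
by rewrite natrX exprVn.
Qed.

(** The main terms of the lattice counts resum to a finite Euler product; the
    error terms are controlled by the bounded product of weights, with s in
    the weights equal to 1/2 - d. *)
Lemma lcm_sum_approx (R : realType) k (f : nat -> R[i]) (d : R) :
  class_A0 f -> 0 < d <= 2^-1 ->
  exists K : R, 0 <= K /\ forall N V (y : R), 0 < y < N%:R -> (N <= V)%N ->
  `|lcm_sum k f (y ^+ 2) -
    (y ^+ k * orthant_volume R k)%:C * \prod_(p < N | prime p) local_partial k V f p|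
  <= (K * (y ^+ k * y `^ (d - 2^-1)))%:C.
Proof.
move=> fA /andP[d0 d2]; have fM : multiplicative_fun f by case: fA.
have [C [C0 [jump _]]] := class_A0_jump fA.
have [K [K0 EK]] := euler_product_le k C0 d0.
exists (k%:R * K); split; first by rewrite mulr_ge0.
move=> N V y /andP[y0 yN] NV.
rewrite (lcm_sum_systems k fM _ NV); last first.
  by rewrite ltr_sqr ?nnegrE // ltW.
rewrite -sum_systems_prod mulr_sumr -sumrB.
apply: le_trans (ler_norm_sum _ _ _) _.
apply: (@le_trans _ _ (\sum_(phi : {ffun 'I_N -> prime_choice k V})
  (y ^+ k * (\prod_(p < N) prime_weight C p (phi p) / (\prod_i (system_divisor phi i)%:R)
     * \sum_i Num.min 1 ((system_divisor phi i)%:R / y)))%:C)).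
  apply: ler_sum => phi _.
  have y0N : 0 <= y < N%:R by rewrite ltW.
  have /andP[lo hi] := lattice_count_bounds (system_divisor_gt0 phi) y0N.
  set D : R := \prod_i _ in lo hi *; set S := \sum_i _ in lo *.
  have DE : \prod_i (system_divisor phi i)%:R = D%:C :> R[i].
    by rewrite rmorph_prod; apply: eq_bigr => i _; rewrite rmorph_nat.
  set L := lattice_count _ _ _ in lo hi *.
  have -> : system_coeff f phi * L%:C - (y ^+ k * orthant_volume R k)%:C *
      (system_coeff f phi / \prod_i (system_divisor phi i)%:R)
      = system_coeff f phi * (L - y ^+ k / D * orthant_volume R k)%:C.
    rewrite DE -fmorphV rmorphB !rmorphM /= mulrBr; congr (_ - _).
    by ring.
  have W0 : 0 <= \prod_(p < N) prime_weight C p (phi p).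
    by apply: prodr_ge0 => p _; exact: prime_weight_ge0.
  have h1 : `|system_coeff f phi| <= (\prod_(p < N) prime_weight C p (phi p))%:C.
    rewrite normr_prod rmorph_prod; apply: ler_prod => p _.
    by rewrite normr_ge0 prime_coeff_bound.
  have h2 : `|(L - y ^+ k / D * orthant_volume R k)%:C| <= (y ^+ k / D * S)%:C.
    rewrite normc_def /= expr0n addr0 sqrtr_sqr lecR ler_norml.
    move: lo hi; set Y := y ^+ k / D; set v := orthant_volume R k => lo hi.
    have : 0 <= Y * S.
      rewrite mulr_ge0 ?divr_ge0 ?exprn_ge0 ?(ltW y0) ?prodr_ge0 //.
      by apply: sumr_ge0 => i _; rewrite le_min ler01 divr_ge0 // ltW.
    by move=> YS; apply/andP; split; lra.
  rewrite normrM; apply: le_trans (ler_pM _ _ h1 h2) _ => //.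
  rewrite -rmorphM lecR le_eqVlt; apply/orP; left; apply/eqP.
  by ring.
rewrite -rmorph_sum lecR -mulr_sumr mulrCA ler_wpM2l ?exprn_ge0 ?(ltW y0) //.
have s01 : (0 : R) <= 2^-1 - d <= 1 by apply/andP; split; lra.
apply: le_trans (ler_sum _ (fun phi _ => system_weight_bound phi C0 s01 y0)) _.
rewrite -mulr_sumr opprB [leRHS]mulrAC.
rewrite -[X in _ * X <= _](@bigA_distr_bigA _ _ _ _ _ _ _ (fun (p : 'I_N) (j : prime_choice k V) =>
  prime_weight C p j *
    (if prime p then p%:R `^ (2^-1 - d - 1) ^+ choice_height j else 1))).
by rewrite ler_wpM2l // mulr_ge0 // powR_ge0.
Qed.

(** * Limits in R[i] *)

(** Limits and bounds in R[i] are tested against real radii. *)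
Lemma cvg_complexP (R : realType) (T : Type) (F : set_system T) (FF : Filter F)
    (u : T -> R[i]) (l : R[i]) :
  u @ F --> l <-> forall e : R, 0 < e -> \forall t \near F, `|u t - l| <= e%:C.
Proof.
split=> [/cvgrPdist_le h e e0|h].
  have e0C : 0 < e%:C :> R[i] by rewrite ltcR.
  by apply: filterS (h _ e0C) => t; rewrite distrC.
apply/cvgrPdist_le => e e0.
have /complex_realP[r er] := gtr0_real e0.
have r0 : 0 < r by move: e0; rewrite er ltcR.
by apply: filterS (h r r0) => t; rewrite distrC er.
Qed.

Lemma cvgn_complexP (R : realType) (u : nat -> R[i]) (l : R[i]) :
  u n @[n --> \oo] --> l <->
  forall e : R, 0 < e -> exists N, forall n, (N <= n)%N -> `|u n - l| <= e%:C.
Proof.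
rewrite cvg_complexP; split=> h e e0.
  by have [N _ hN] := h e e0; exists N => n Nn; exact: hN.
by have [N hN] := h e e0; exists N.
Qed.

Lemma normc_real (R : realType) (z : R[i]) : exists2 r : R, 0 <= r & `|z| = r%:C.
Proof. by rewrite normc_def; eexists; last reflexivity; rewrite sqrtr_ge0. Qed.

Lemma ReIm_le_norm (R : realType) (z : R[i]) (e : R) :
  `|z| <= e%:C -> `|complex.Re z| <= e /\ `|complex.Im z| <= e.
Proof.
rewrite normc_def lecR => h; split; apply: le_trans h; rewrite -sqrtr_sqr.
  by rewrite ler_wsqrtr // lerDl sqr_ge0.
by rewrite ler_wsqrtr // lerDr sqr_ge0.
Qed.

Lemma norm_le_ReIm (R : realType) (z : R[i]) (e1 e2 : R) :
  `|complex.Re z| <= e1 -> `|complex.Im z| <= e2 -> `|z| <= (e1 + e2)%:C.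
Proof.
move=> h1 h2; have -> : z = (complex.Re z)%:C + 'i%C * (complex.Im z)%:C by exact: complexE.
rewrite (le_trans (ler_normD _ _)) // normrM.
have -> : `|'i%C : R[i]| = 1 by rewrite normc_def /= expr0n expr1n add0r sqrtr1.
rewrite mul1r rmorphD; apply: lerD.
  by rewrite normc_def /= expr0n addr0 sqrtr_sqr lecR.
by rewrite normc_def /= expr0n addr0 sqrtr_sqr lecR.
Qed.

Lemma cauchy_real (R : realType) (u : nat -> R) :
  (forall e : R, 0 < e -> exists N, forall n, (N <= n)%N -> `|u n - u N| <= e) ->
  exists l : R, u n @[n --> \oo] --> l.
Proof.
move=> h; suff : cvg (u n @[n --> \oo]) by exists (lim (u n @[n --> \oo])).
apply/cauchy_cvgP/cauchy_exP => e e0.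
have e20 : 0 < e / 2 by rewrite divr_gt0.
have [N hN] := h _ e20; exists (u N); exists N => // n Nn.
rewrite /ball /= distrC; apply: le_lt_trans (hN n Nn) _.
by rewrite ltr_pdivrMr // ltr_pMr // ltr1n.
Qed.

(** Completeness of R[i], from that of R applied to real and imaginary
    parts. *)
Lemma cauchy_complex (R : realType) (u : nat -> R[i]) :
  (forall e : R, 0 < e -> exists N, forall n, (N <= n)%N -> `|u n - u N| <= e%:C) ->
  exists l : R[i], u n @[n --> \oo] --> l.
Proof.
move=> h.
have [a ha] : exists l : R, (complex.Re (u n)) @[n --> \oo] --> l.
  apply: cauchy_real => e e0; have [N hN] := h e e0; exists N => n Nn.
  by have [] := ReIm_le_norm (hN n Nn); rewrite raddfB.
have [b hb] : exists l : R, (complex.Im (u n)) @[n --> \oo] --> l.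
  apply: cauchy_real => e e0; have [N hN] := h e e0; exists N => n Nn.
  by have [_] := ReIm_le_norm (hN n Nn); rewrite raddfB.
exists (a +i* b); apply/cvgn_complexP => e e0.
have e20 : 0 < e / 2 by rewrite divr_gt0.
have /cvgrPdist_le/(_ _ e20)[N1 _ h1] := ha.
have /cvgrPdist_le/(_ _ e20)[N2 _ h2] := hb.
exists (maxn N1 N2) => n; rewrite geq_max => /andP[n1 n2].
rewrite [e]splitr; apply: norm_le_ReIm; rewrite raddfB /= distrC.
  exact: h1.
exact: h2.
Qed.

(** Closed balls are stable under limits; the affine form a - b z is the one in
    which the approximations are stated. *)
Lemma norm_le_cvgn (R : realType) (u : nat -> R[i]) (l a b : R[i]) (c : R) N :
  u n @[n --> \oo] --> l ->
  (forall n, (N <= n)%N -> `|a - b * u n| <= c%:C) -> `|a - b * l| <= c%:C.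
Proof.
move=> /cvgn_complexP ul h.
have [r r0 rE] := normc_real (a - b * l); have [s s0 sE] := normc_real b.
rewrite rE lecR; apply/ler_addgt0Pr => e e0.
have s1 : 0 < s + 1 by rewrite ltr_wpDl.
have [M hM] := ul _ (divr_gt0 e0 s1).
have := h _ (leq_maxl N M); have := hM _ (leq_maxr N M).
set z := u _ => hz hc.
rewrite -lecR -rE rmorphD.
have -> : a - b * l = (a - b * z) + b * (z - l) by ring.
apply: le_trans (ler_normD _ _) _; apply: lerD => //.
rewrite normrM sE; apply: le_trans (ler_wpM2l _ hz) _; first by rewrite ler0c.
rewrite -rmorphM lecR mulrCA ler_piMr ?(ltW e0) //.
by rewrite ler_pdivrMr // mul1r lerDl ler01.
Qed.

Lemma cvgn_complexMr (R : realType) (u : nat -> R[i]) (l c : R[i]) :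
  u n @[n --> \oo] --> l -> u n * c @[n --> \oo] --> l * c.
Proof.
move=> /cvgn_complexP ul; apply/cvgn_complexP => e e0.
have [s s0 sE] := normc_real c.
have s1 : 0 < s + 1 by rewrite ltr_wpDl.
have [N hN] := ul _ (divr_gt0 e0 s1); exists N => n Nn.
rewrite -mulrBl normrM sE; apply: le_trans (ler_wpM2r _ (hN n Nn)) _.
  by rewrite ler0c.
rewrite -rmorphM lecR mulrAC ler_pdivrMr //.
by rewrite ler_wpM2l ?(ltW e0) // lerDl ler01.
Qed.

Lemma cvgn_complexB0 (R : realType) (u v : nat -> R[i]) (l : R[i]) :
  u n @[n --> \oo] --> l ->
  (forall e : R, 0 < e -> exists N, forall n, (N <= n)%N -> `|v n| <= e%:C) ->
  u n - v n @[n --> \oo] --> l.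
Proof.
move=> /cvgn_complexP ul v0; apply/cvgn_complexP => e e0.
have e20 : 0 < e / 2 by rewrite divr_gt0.
have [N1 h1] := ul _ e20; have [N2 h2] := v0 _ e20.
exists (maxn N1 N2) => n; rewrite geq_max => /andP[n1 n2].
rewrite addrAC [e]splitr rmorphD; apply: le_trans (ler_normB _ _) _.
by apply: lerD; [exact: h1 | exact: h2].
Qed.

Lemma partial_sumE (I : choiceType) (V : zmodType) (a : I -> V) (A : {fset I}) :
  summability.partial_sum a A = \sum_(i <- enum_fset A) a i.
Proof. by rewrite /summability.partial_sum big_seq_fsetE. Qed.

Lemma sum_fset_sub (I : choiceType) (V : zmodType) (a : I -> V) (A B : {fset I}) :
  fsubset A B ->
  \sum_(i <- enum_fset B) a i - \sum_(i <- enum_fset A) a i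
  = \sum_(i <- enum_fset B | i \notin A) a i.
Proof.
move=> /fsubsetP AB; rewrite (bigID (mem A)) /=.
suff -> : \sum_(i <- enum_fset B | i \in A) a i = \sum_(i <- enum_fset A) a i.
  by rewrite addrAC subrr add0r.
rewrite -big_filter; apply: perm_big.
apply: uniq_perm; rewrite ?filter_uniq ?fset_uniq // => i.
rewrite mem_filter; apply/andP/idP => [[]//|iA]; split=> //; exact: AB.
Qed.

(** An absolutely summable family can be summed along any exhausting sequence
    of finite sets: a finite A containing box V lies in some box M, so the
    difference of the two partial sums is at most the difference of the sums
    of the majorant over box M and box V. *)
Lemma partial_sum_cvg (R : realType) (I : choiceType) (a : I -> R[i]) (w : I -> R)
    (box : nat -> {fset I}) (l : R[i]) (Q : R) :
  (forall i, `|a i| <= (w i)%:C) ->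
  (forall A : {fset I}, exists V, fsubset A (box V)) ->
  (forall V, \sum_(i <- enum_fset (box V)) w i <= Q) ->
  \sum_(i <- enum_fset (box V)) w i @[V --> \oo] --> Q ->
  \sum_(i <- enum_fset (box V)) a i @[V --> \oo] --> l ->
  summability.partial_sum a @ summability.totally --> l.
Proof.
move=> aw boxA Qle /cvgrPdist_le Qlim /cvgn_complexP alim.
have TF := @summability.totally_filter I.
apply/cvg_complexP => e e0; have e20 : 0 < e / 2 by rewrite divr_gt0.
have [N1 _ h1] := Qlim _ e20; have [N2 h2] := alim _ e20.
pose V := maxn N1 N2.
have w0 i : 0 <= w i by rewrite -(@ler0c R); apply: le_trans (aw i).
exists (box V) => // A /= VA; rewrite partial_sumE.
have [M AM] := boxA A.
rewrite -[X in X - l](subrK (\sum_(i <- enum_fset (box V)) a i)).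
rewrite -addrA [e]splitr rmorphD; apply: le_trans (ler_normD _ _) _.
apply: lerD; last by apply: h2; exact: leq_maxr.
rewrite sum_fset_sub //.
apply: (@le_trans _ _ (\sum_(i <- enum_fset A | i \notin box V) w i)%:C).
  apply: le_trans (ler_norm_sum _ _ _) _; rewrite rmorph_sum.
  by apply: ler_sum => i _; exact: aw.
rewrite lecR -sum_fset_sub //.
have h := h1 _ (leq_maxl N1 N2); have := Qle M; rewrite -/V in h.
have : \sum_(i <- enum_fset A) w i <= \sum_(i <- enum_fset (box M)) w i.
  by rewrite -subr_ge0 sum_fset_sub // sumr_ge0.
move: h => /ler_normlW.
lra.
Qed.

Definition exponent_box (k V : nat) : {fset {ffun 'I_k -> nat}} :=
  seq_fset tt [seq ord_tuple g | g : {ffun 'I_k -> 'I_V.+1}].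

Lemma sum_exponent_box (W : zmodType) k V (F : {ffun 'I_k -> nat} -> W) :
  \sum_(n <- enum_fset (exponent_box k V)) F n =
  \sum_(g : {ffun 'I_k -> 'I_V.+1}) F (ord_tuple g).
Proof.
rewrite -[RHS](big_map (@ord_tuple k V.+1) xpredT F); apply: perm_big.
apply: uniq_perm; first exact: fset_uniq.
  rewrite map_inj_uniq ?index_enum_uniq // => g g' /ffunP h.
  by apply/ffunP => i; apply/val_inj; have := h i; rewrite !ffunE.
move=> n; rewrite seq_fsetE; apply/mapP/mapP => -[g _ ->];
  by exists g; rewrite ?mem_enum ?mem_index_enum.
Qed.

Lemma exponent_box_cover k (A : {fset {ffun 'I_k -> nat}}) :
  exists V, fsubset A (exponent_box k V).
Proof.
exists (\max_(n <- enum_fset A) \max_i n i).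
apply/fsubsetP => n nA; rewrite seq_fsetE; apply/mapP.
have nV i : (n i < (\max_(n <- enum_fset A) \max_i n i).+1)%N.
  rewrite ltnS (leq_trans (leq_bigmax i)) //.
  exact: (leq_bigmax_seq (F := fun n : {ffun 'I_k -> nat} => \max_i n i) n nA isT).
exists [ffun i => Ordinal (nV i)]; first by rewrite mem_enum.
by apply/ffunP => i; rewrite !ffunE.
Qed.

(** * Local factors *)

(** The sum over the box factors over the coordinates into the k-th power of a
    finite geometric series. *)
Lemma sum_box_le (A : comNzRingType) k V a (q : A) : (a <= V)%N ->
  (1 - q) ^+ k *
  \sum_(g : {ffun 'I_k -> 'I_V.+1}) q ^+ (\sum_i g i) * [forall i, (g i <= a)%N]%:R
  = (1 - q ^+ a.+1) ^+ k.
Proof.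
move=> aV.
transitivity ((1 - q) ^+ k * \prod_(i < k) \sum_(b < V.+1) q ^+ b * (b <= a)%N%:R).
  rewrite bigA_distr_bigA /=; congr (_ * _); apply: eq_bigr => g _.
  rewrite big_split /= prodrXr; congr (_ * _).
  case: (boolP [forall i, _]) => [/forallP h|].
    by rewrite big1 // => i _; rewrite h.
  rewrite negb_forall => /existsP [] i /negPf h.
  by rewrite (bigD1 i) //= h mul0r.
rewrite prodr_const card_ord -exprMn; congr (_ ^+ k).
rewrite -(big_mkord xpredT (fun b => q ^+ b * (b <= a)%N%:R)).
suff -> : \sum_(0 <= b < V.+1) q ^+ b * (b <= a)%N%:R = \sum_(b < a.+1) q ^+ b.
  by rewrite -opprB mulNr -subrX1 opprB.
rewrite (big_cat_nat (n := a.+1)) //= [X in _ + X]big_nat_cond.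
rewrite [X in _ + X]big1 ?addr0; last first.
  by move=> b /andP[/andP[ab _] _]; rewrite leqNgt ab mulr0.
rewrite -(big_mkord xpredT (fun b => q ^+ b)) !big_nat; apply: eq_bigr => b /andP[_ ba].
by rewrite -ltnS ba mulr1.
Qed.

(** Writing f(p^max nu) as a telescoping sum reduces the sum over the box to
    the sums over the smaller boxes max nu <= a.  The last term is the effect
    of truncating the geometric series at V. *)
Lemma local_term_box (R : realType) k V (f : nat -> R[i]) p : f 1%N = 1 ->
  (1 - p%:R^-1) ^+ k *
    \sum_(n <- enum_fset (exponent_box k V)) local_term f p n
  = local_partial k V f p - f (p ^ V)%N * (1 - (1 - p%:R^-1 ^+ V.+1) ^+ k).
Proof.
move=> f1; set q : R[i] := p%:R^-1.
pose J a := f (p ^ a.+1)%N - f (p ^ a)%N.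
pose t a := (1 - q ^+ a.+1) ^+ k.
have fV : f (p ^ V)%N = 1 + \sum_(a < V) J a.
  rewrite -(big_mkord xpredT J) (@telescope_sumr _ _ _ (fun a => f (p ^ a)%N)) //.
  by rewrite expn0 f1 addrC subrK.
rewrite sum_exponent_box.
pose X a (g : {ffun 'I_k -> 'I_V.+1}) : R[i] :=
  q ^+ (\sum_i g i) * [forall i, (g i <= a)%N]%:R.
have XE a : (a <= V)%N -> (1 - q) ^+ k * \sum_g X a g = t a.
  exact: sum_box_le.
have termE g : local_term f p (ord_tuple g) = X V g + \sum_(a < V) J a * (X V g - X a g).
  have gV i : (ord_tuple g i <= V)%N by rewrite ffunE -ltnS.
  rewrite /local_term -(telescope_max p f1 gV) -exprVn -/q.
  have XV : X V g = q ^+ (\sum_i g i).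
    rewrite /X (_ : [forall i, _] = true) ?mulr1 //.
    by apply/forallP => i; rewrite -ltnS.
  rewrite XV; have -> : (\sum_i ord_tuple g i = \sum_i g i)%N.
    by apply: eq_bigr => i _; rewrite ffunE.
  rewrite mulrDl mul1r; congr (_ + _); rewrite mulr_suml; apply: eq_bigr => a _.
  rewrite -mulrA; congr (_ * _); rewrite /X.
  have -> : (a < \max_i ord_tuple g i)%N = ~~ [forall i, (g i <= a)%N].
    rewrite ltnNge; congr (~~ _); apply/bigmax_leqP/forallP => h i.
      by have := h i isT; rewrite ffunE.
    by rewrite ffunE.
  by case: [forall i, _]; rewrite ?mul0r ?mulr1 ?subrr // mulr0 subr0 mul1r.
rewrite (eq_bigr _ (fun g _ => termE g)) big_split /= exchange_big /= mulrDr XE //.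
have -> : (1 - q) ^+ k * \sum_(a < V) \sum_g J a * (X V g - X a g)
    = \sum_(a < V) J a * (t V - t a).
  rewrite mulr_sumr; apply: eq_bigr => a _.
  by rewrite -mulr_sumr sumrB mulrCA mulrBr !XE // ltnW.
rewrite fV /local_partial -/q -/(t V).
have -> : \sum_(a < V) J a * (t V - t a) = (\sum_(a < V) J a) * t V - \sum_(a < V) J a * t a.
  by rewrite mulr_suml -sumrB; apply: eq_bigr => a _; rewrite mulrBr.
have -> : \sum_(a < V) (f (p ^ a.+1)%N - f (p ^ a)%N) * (1 - (1 - q ^+ a.+1) ^+ k)
    = \sum_(a < V) J a - \sum_(a < V) J a * t a.
  by rewrite -sumrB; apply: eq_bigr => a _; rewrite mulrBr mulr1.
by ring.
Qed.

Lemma bernoulli_le (R : realType) (x : R) k : 0 <= x <= 1 ->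
  0 <= 1 - (1 - x) ^+ k <= k%:R * x.
Proof.
move=> /andP[x0 x1]; elim: k => [|k /andP[IH0 IH1]].
  by rewrite expr0 subrr mul0r lexx.
have x10 : 0 <= 1 - x by lra.
have t0 : 0 <= (1 - x) ^+ k by rewrite exprn_ge0.
by rewrite exprS -natr1; apply/andP; split; nra.
Qed.

Lemma prime_inv (R : realType) p : prime p -> 0 < (p%:R^-1 : R) <= 2^-1.
Proof.
move=> pp; rewrite invr_gt0 ltr0n prime_gt0 //= lef_pV2 ?posrE ?ltr0n ?prime_gt0 //.
by rewrite ler_nat prime_gt1.
Qed.

Lemma norm_one_minus_pow (R : realType) k p a : prime p ->
  `|1 - (1 - p%:R^-1 ^+ a.+1) ^+ k : R[i]| <= (k%:R * p%:R^-1 ^+ a.+1)%:C.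
Proof.
move=> pp; have /andP[q0 q1] := prime_inv R pp.
have x01 : 0 <= (p%:R^-1 ^+ a.+1 : R) <= 1.
  by rewrite exprn_ge0 ?(ltW q0) //= exprn_ile1 ?(ltW q0) //; lra.
have /andP[b0 b1] := bernoulli_le k x01.
have -> : 1 - (1 - p%:R^-1 ^+ a.+1) ^+ k = (1 - (1 - p%:R^-1 ^+ a.+1) ^+ k)%:C :> R[i].
  by rewrite !(rmorphB, rmorphXn, rmorph1, fmorphV, rmorph_nat).
by rewrite ger0_norm ?lecR ?ler0c.
Qed.

(** All tails below have the form c q^(n+1) with q = 1/p. *)
Lemma cvg_geometric_scale (R : realType) (c q : R) : 0 <= c -> 0 < q <= 2^-1 ->
  forall e : R, 0 < e -> exists N, forall n, (N <= n)%N -> c * q ^+ n.+1 <= e.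
Proof.
move=> c0 /andP[q0 q1] e e0.
have : c * q * q ^+ n @[n --> \oo] --> 0.
  rewrite -[X in _ --> X](mulr0 (c * q)); apply: cvgMr; apply: cvg_expr.
  by rewrite ger0_norm ?(ltW q0) //; lra.
move=> /cvgrPdist_le/(_ _ e0)[N _ hN]; exists N => n Nn.
have := hN _ Nn; rewrite /= sub0r normrN ger0_norm ?exprS ?mulrA //.
by rewrite !mulr_ge0 ?exprn_ge0 ?(ltW q0).
Qed.

Lemma cvg_local_partial (R : realType) k (f : nat -> R[i]) p (C : R) : prime p ->
  0 <= C -> (forall a, `|f (p ^ a)%N| <= C%:C) ->
  exists l : R[i], local_partial k V f p @[V --> \oo] --> l.
Proof.
move=> pp C0 fC; apply: cauchy_complex => e e0.
have q01 := prime_inv R pp; have /andP[q0 q1] := q01; set q : R := p%:R^-1 in q0 q1 q01.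
have c0 : 0 <= 8 * C * k%:R by rewrite !mulr_ge0.
have [N hN] := cvg_geometric_scale c0 q01 e0; exists N => n Nn.
apply: le_trans (_ : _ <= (8 * C * k%:R * q ^+ N.+1)%:C) _; last first.
  by rewrite lecR hN.
rewrite /local_partial opprD addrACA subrr add0r.
set F := fun a => (f (p ^ a.+1)%N - f (p ^ a)%N) * (1 - (1 - p%:R^-1 ^+ a.+1) ^+ k).
have Fle a : `|F a| <= (2 * C * k%:R * q ^+ a.+1)%:C.
  rewrite normrM -!mulrA mulrA rmorphM; apply: ler_pM => //.
    rewrite (le_trans (ler_normB _ _)) // mulr_natl mulr2n rmorphD.
    by apply: lerD.
  exact: norm_one_minus_pow.
rewrite -!(big_mkord xpredT F) (big_cat_nat (n := N)) //= addrAC subrr add0r.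
apply: le_trans (ler_norm_sum _ _ _) _.
apply: (@le_trans _ _ (\sum_(N <= a < n) (2 * C * k%:R * q ^+ a.+1)%:C)).
  by apply: ler_sum => a _; exact: Fle.
rewrite -rmorph_sum lecR -mulr_sumr.
have -> : \sum_(N <= a < n) q ^+ a.+1 = q ^+ N.+1 * \sum_(a < n - N) q ^+ a.
  rewrite -{1}[N]add0n big_addn big_mkord mulr_sumr.
  by apply: eq_bigr => a _; rewrite -exprD addnC addSn addnC.
have S4 : \sum_(a < n - N) q ^+ a <= 4.
  by apply: geometric_le; apply/andP; split; lra.
have -> : 8 * C * k%:R * q ^+ N.+1 = (2 * C * k%:R) * (q ^+ N.+1 * 4) by ring.
by rewrite ler_wpM2l ?mulr_ge0 // ler_wpM2l // exprn_ge0 // ltW.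
Qed.

(** The correction term in local_term_box is at most C k p^-(V+1), so the box
    sums converge, and absolute convergence identifies their limit with the
    unordered sum. *)
Lemma cvg_local_factor (R : realType) k (f : nat -> R[i]) p (C : R) : prime p ->
  f 1%N = 1 -> 0 <= C -> (forall a, `|f (p ^ a)%N| <= C%:C) ->
  cvg (summability.partial_sum (local_term (k := k) f p) @ summability.totally) /\
  local_partial k V f p @[V --> \oo] --> local_factor k f p.
Proof.
move=> pp f1 C0 fC; have [l Ll] := cvg_local_partial k pp C0 fC.
have q01 := prime_inv R pp; have /andP[q0 q1] := q01; set q : R := p%:R^-1 in q0 q1 q01.
have q1' : q < 1 by lra.
have qC : p%:R^-1 = q%:C :> R[i] by rewrite fmorphV rmorph_nat.
have qn1 : q != 1 by rewrite lt_eqF.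
have q1n0 : (1 - p%:R^-1) ^+ k != 0 :> R[i].
  by rewrite expf_neq0 // subr_eq0 eq_sym qC fmorph_eq1.
pose l' := l / (1 - p%:R^-1) ^+ k.
have boxl : \sum_(n <- enum_fset (exponent_box k V)) local_term f p n @[V --> \oo] --> l'.
  have -> : (fun V => \sum_(n <- enum_fset (exponent_box k V)) local_term f p n) =
     (fun V => (local_partial k V f p - f (p ^ V)%N * (1 - (1 - p%:R^-1 ^+ V.+1) ^+ k))
               / (1 - p%:R^-1) ^+ k).
    by apply/funext => V; rewrite -local_term_box // mulrC mulKf.
  apply: cvgn_complexMr; apply: cvgn_complexB0 Ll _ => e e0.
  have c0 : 0 <= C * k%:R by rewrite mulr_ge0.
  have [N hN] := cvg_geometric_scale c0 q01 e0; exists N => n Nn.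
  rewrite normrM; apply: le_trans (_ : _ <= (C * k%:R * q ^+ n.+1)%:C) _; last first.
    by rewrite lecR hN.
  by rewrite -mulrA rmorphM; apply: ler_pM => //; exact: norm_one_minus_pow.
pose w (n : {ffun 'I_k -> nat}) : R := C * q ^+ (\sum_i n i).
have wE V : \sum_(n <- enum_fset (exponent_box k V)) w n =
    C / (1 - q) ^+ k * (1 - q ^+ V.+1) ^+ k.
  rewrite sum_exponent_box -mulr_sumr -(@sum_box_le _ k V V q (leqnn V)).
  rewrite -mulrA mulKf; last by rewrite expf_neq0 // subr_eq0 eq_sym.
  congr (_ * _); apply: eq_bigr => g _.
  rewrite (_ : [forall i, _] = true) ?mulr1; last first.
    by apply/forallP => i; rewrite -ltnS.
  by congr (_ ^+ _); apply: eq_bigr => i _; rewrite ffunE.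
have Q0 : 0 <= C / (1 - q) ^+ k by rewrite divr_ge0 // exprn_ge0 // subr_ge0 ltW.
have lim : summability.partial_sum (local_term (k := k) f p) @ summability.totally --> l'.
  apply: (@partial_sum_cvg _ _ _ w (exponent_box k) l' (C / (1 - q) ^+ k)) => //.
  - move=> n; rewrite /local_term /w -exprVn qC normrM rmorphM.
    apply: ler_pM => //; rewrite -rmorphXn.
    by rewrite ger0_norm ?ler0c ?exprn_ge0 // ltW.
  - exact: exponent_box_cover.
  - move=> V; rewrite wE ler_piMr // exprn_ile1 //.
      by rewrite subr_ge0 exprn_ile1 // ltW.
    by rewrite gerBl exprn_ge0 // ltW.
  - have -> : (fun V => \sum_(n <- enum_fset (exponent_box k V)) w n) =
        (fun V => C / (1 - q) ^+ k * (1 - q ^+ V.+1) ^+ k) by apply/funext.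
    rewrite -[X in _ --> X]mulr1; apply: cvgMr.
    apply/cvgrPdist_le => e e0.
    have [N hN] := cvg_geometric_scale (ler0n R k) q01 e0; exists N => // V NV.
    have x01 : 0 <= q ^+ V.+1 <= 1.
      by rewrite exprn_ge0 ?(ltW q0) //= exprn_ile1 ?(ltW q0) ?(ltW q1').
    have /andP[b0 b1] := bernoulli_le k x01.
    by rewrite /= ger0_norm // (le_trans b1) // hN.
split; first by apply/cvg_ex; exists l'.
suff -> : local_factor k f p = l by [].
rewrite /local_factor /summability.sum.
have TF := @summability.totally_filter {ffun 'I_k -> nat}.
rewrite (cvg_lim _ lim) //.
by rewrite mulrC divfK.
Qed.

(** * The asymptotic formula *)

Lemma cvgn_complexM (R : realType) (u v : nat -> R[i]) (a b : R[i]) :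
  u n @[n --> \oo] --> a -> v n @[n --> \oo] --> b ->
  u n * v n @[n --> \oo] --> a * b.
Proof.
move=> /cvgn_complexP ua /cvgn_complexP vb; apply/cvgn_complexP => e e0.
have [r r0 rE] := normc_real a; have [s s0 sE] := normc_real b.
have c0 : 0 < r + s + 1 by rewrite ltr_wpDl // addr_ge0.
(* The radius t for both factors gives t t + r t + t s <= t (1 + r + s) <= e. *)
pose t := Num.min 1 (e / (r + s + 1)).
have t0 : 0 < t by rewrite lt_min ltr01 divr_gt0.
have t1 : t <= 1 by rewrite ge_min lexx.
have te : t * (r + s + 1) <= e by rewrite -ler_pdivlMr // ge_min lexx orbT.
have [N1 h1] := ua _ t0; have [N2 h2] := vb _ t0.
exists (maxn N1 N2) => n; rewrite geq_max => /andP[/h1 hu /h2 hv].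
have -> : u n * v n - a * b = (u n - a) * (v n - b) + a * (v n - b) + (u n - a) * b.
  by ring.
apply: (@le_trans _ _ (t * t + r * t + t * s)%:C); last first.
  rewrite lecR; apply: le_trans te; rewrite !mulrDr mulr1 [t * r]mulrC.
  have : t * t <= t by rewrite ler_piMr // ltW.
  by lra.
rewrite !rmorphD !rmorphM /=; apply: le_trans (ler_normD _ _) _; apply: lerD.
  apply: le_trans (ler_normD _ _) _; apply: lerD; rewrite normrM.
    exact: ler_pM.
  by rewrite rE; apply: ler_wpM2l => //; rewrite ler0c.
by rewrite normrM sE; apply: ler_wpM2r => //; rewrite ler0c.
Qed.

Lemma cvgn_complex_prod (R : realType) N (P : pred nat) (u : nat -> nat -> R[i])
    (l : nat -> R[i]) :
  (forall p, P p -> u p n @[n --> \oo] --> l p) ->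
  \prod_(p < N | P p) u p n @[n --> \oo] --> \prod_(p < N | P p) l p.
Proof.
move=> ul.
have rec (F : nat -> R[i]) M : \prod_(p < M.+1 | P p) F p =
    \prod_(p < M | P p) F p * (if P M then F M else 1).
  by rewrite big_mkcond big_ord_recr -big_mkcond.
elim: N => [|N IH].
  have -> : (fun n => \prod_(p < 0 | P p) u p n) = (fun=> 1).
    by apply/funext => n; rewrite big_ord0.
  by rewrite big_ord0; exact: cvg_cst.
have -> : (fun n => \prod_(p < N.+1 | P p) u p n) =
    (fun n => \prod_(p < N | P p) u p n * (if P N then u N n else 1)).
  by apply/funext => n; exact: (rec (fun p => u p n)).
rewrite rec; apply: cvgn_complexM IH _.
case: ifP => PN; [exact: ul | exact: cvg_cst].
Qed.

Lemma orthant_volume_gt0 (R : realType) k : 0 < orthant_volume R k.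
Proof.
have c0 j : 0 < cap_primitive j (1 : R).
  have /andP[c0 _] := @cap_primitive1_itv R j.
  rewrite lt_neqAle c0 andbT eq_sym; apply/eqP => c00.
  have := @cap_primitive1_mulS R j; rewrite c00 mul0r => /esym/eqP.
  by rewrite mulf_eq0 invr_eq0 mulf_eq0 !pnatr_eq0 /= orbF gt_eqF ?pi_gt0.
by elim: k => [|k IH] /=; rewrite ?ltr01 ?mulr_gt0.
Qed.

(** The bound of lcm_sum_approx is uniform in V, so it survives V going to
    infinity. *)
Lemma lcm_sum_euler_partial (R : realType) k (f : nat -> R[i]) (d : R) :
  class_A0 f -> 0 < d <= 2^-1 ->
  exists K : R, 0 <= K /\ forall N (y : R), 0 < y < N%:R ->
  `|lcm_sum k f (y ^+ 2) - (y ^+ k * orthant_volume R k)%:C * euler_partial k f N|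
  <= (K * (y ^+ k * y `^ (d - 2^-1)))%:C.
Proof.
move=> fA d01; have [K [K0 HK]] := lcm_sum_approx k fA d01.
have f1 : f 1%N = 1 by case: fA => -[].
have [C [C0 [_ fC]]] := class_A0_jump fA.
exists K; split=> // N y yN.
apply: (@norm_le_cvgn _ (fun V => \prod_(p < N | prime p) local_partial k V f p) _ _ _ _ N).
  apply: (@cvgn_complex_prod _ N prime (fun p V => local_partial k V f p)
    (local_factor k f)) => p pp.
  exact: (cvg_local_factor k pp f1 C0 (fun a => fC p a pp)).2.
by move=> V NV; exact: HK.
Qed.

(** Two partial products beyond y both approximate the same lattice sum with
    relative error O(y^(-1/4)); letting y grow makes them a Cauchy sequence. *)
Lemma cvg_euler_partial (R : realType) k (f : nat -> R[i]) :
  class_A0 f -> cvg (euler_partial k f @ \oo).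
Proof.
move=> fA; have d01 : 0 < (4^-1 : R) <= 2^-1 by apply/andP; split; lra.
have [K [K0 HK]] := lcm_sum_euler_partial k fA d01.
suff [l ll] : exists l : R[i], euler_partial k f n @[n --> \oo] --> l.
  by apply/cvg_ex; exists l.
apply: cauchy_complex => e e0.
have v0 := orthant_volume_gt0 R k; set v := orthant_volume R k in HK v0.
(* The choice y = c^4 makes the relative error 2 K y^(-1/4) / v at most e. *)
pose c := (2 * K + 1) / (e * v).
have K1 : 0 < 2 * K + 1 by rewrite ltr_wpDl // mulr_ge0.
have c0 : 0 < c by rewrite divr_gt0 // mulr_gt0.
pose y := c `^ 4; have y0 : 0 < y by rewrite powR_gt0.
have yE : y `^ (4^-1 - 2^-1) = c^-1.
  rewrite -powRrM (_ : 4 * (4^-1 - 2^-1) = -1 :> R); last by field.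
  by rewrite powR_inv1 // ltW.
have yN n : ((Num.truncn y).+1 <= n)%N -> 0 < y < n%:R.
  move=> h; rewrite y0 (lt_le_trans (truncnS_gt y)) // ler_nat //.
exists (Num.truncn y).+1 => n Nn.
have h1 := HK _ _ (yN _ Nn); have h2 := HK _ _ (yN _ (leqnn _)).
set S := lcm_sum _ _ _ in h1 h2; set b := (y ^+ k * v)%:C in h1 h2.
have yk0 : 0 < y ^+ k by rewrite exprn_gt0.
have h : `|b * (euler_partial k f n - euler_partial k f (Num.truncn y).+1)|
    <= (2 * (K * (y ^+ k * c^-1)))%:C.
  have -> : b * (euler_partial k f n - euler_partial k f (Num.truncn y).+1) =
    (S - b * euler_partial k f (Num.truncn y).+1) - (S - b * euler_partial k f n).
    by ring.
  rewrite mulr_natl mulr2n rmorphD -yE; apply: le_trans (ler_normB _ _) _.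
  exact: lerD.
have [r r0 rE] := normc_real (euler_partial k f n - euler_partial k f (Num.truncn y).+1).
move: h; rewrite normrM rE /b ger0_norm ?ler0c ?mulr_ge0 ?(ltW yk0) ?(ltW v0) //.
rewrite -rmorphM !lecR /c invf_div => h.
have E1 : y ^+ k * v * r <= y ^+ k * v * (2 * K * e / (2 * K + 1)).
  apply: le_trans h _; rewrite le_eqVlt; apply/orP; left; apply/eqP.
  by field; rewrite gt_eqF.
rewrite ler_pM2l ?mulr_gt0 // in E1; apply: le_trans E1 _.
by rewrite ler_pdivrMr // mulrDr mulr1 [e * _]mulrC lerDl ltW.
Qed.

Theorem theorem3p10 (R : realType) (k : nat) (f : nat -> R[i]) :
  (2 <= k)%N -> class_A0 f ->
  (forall p : nat, prime p ->
     cvg (summability.partial_sum (local_term (k := k) f p)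
            @ summability.totally)) /\
  cvg (euler_partial k f @ \oo) /\
  forall eps : R, 0 < eps ->
    exists M : R, \forall x \near +oo%R,
      `|lcm_sum k f x
          - (ball_volume R k / 2 ^+ k * x `^ (k%:R / 2))%:C
              * euler_constant k f|
        <= (M * x `^ (k%:R / 2 - 4^-1 + eps))%:C.
Proof.
move=> _ fA; have f1 : f 1%N = 1 by case: fA => -[].
have [C [C0 [_ fC]]] := class_A0_jump fA.
split=> [p pp|].
  exact: (cvg_local_factor k pp f1 C0 (fun a => fC p a pp)).1.
have cE := @cvg_euler_partial R k f fA; split=> // eps eps0.
(* An extra factor y^d is x^(d/2), which x^eps absorbs. *)
pose d : R := Num.min 2^-1 eps.
have d01 : 0 < d <= 2^-1 by rewrite lt_min eps0 invr_gt0 ltr0n /= ge_min lexx.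
have [K [K0 HK]] := lcm_sum_euler_partial k fA d01.
exists K; near=> x; have x1 : 1 <= x by near: x; apply: nbhs_pinfty_ge; rewrite num_real.
have x0 : 0 < x by exact: lt_le_trans x1.
pose y := Num.sqrt x; have y0 : 0 < y by rewrite sqrtr_gt0.
have yx : y ^+ 2 = x by rewrite sqr_sqrtr // ltW.
have ys s : y `^ s = x `^ (s / 2).
  by rewrite /y -powR12_sqrt ?(ltW x0) // -powRrM mulrC.
have yk : y ^+ k = x `^ (k%:R / 2) by rewrite -ys powR_mulrn // ltW.
rewrite ball_volumeE -yk mulrC [orthant_volume R k * _]mulrC [euler_constant _ _ * _]mulrC -{1}yx.
apply: (@le_trans _ _ (K * (y ^+ k * y `^ (d - 2^-1)))%:C).
  apply: (@norm_le_cvgn _ (euler_partial k f) _ _ _ _ (Num.truncn y).+1).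
    exact: cE.
  move=> N yN; apply: HK; rewrite y0 (lt_le_trans (truncnS_gt y)) // ler_nat //.
rewrite lecR ler_wpM2l // yk ys -powRD; last by rewrite (gt_eqF x0) implybT.
apply: ler_powR => //; have : d <= eps by rewrite ge_min lexx orbT.
lra.
Unshelve. all: end_near. Qed.
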